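(* Let $\mathbf{U}\subset\mathbb{R}^d$ be open, $\mathbf{x}_0\in\mathbf{U}$ and $\mathbf{f}:\mathbf{U}\to\mathbb{R}^n$ be $l$-nondegenerate at $\mathbf{x}_0$. Then there exist a ball $B_0$ centred at $\mathbf{x}_0$ with $2B_0\subset\mathbf{U}$ and a constant $C_1>0$ depending on $\mathbf{x}_0$ such that for any ball $B\subset B_0$ of radius $r>0$, any $\delta>0$ and any $\mathbf{a}\in\mathbb{R}^n$ satisfying \[\Vert\mathbf{a}\Vert\ge\max\Big\{\frac{1}{4nLr^2},\frac{ndL}{C_1^2}\Big\},\qquad L:=\sup_{\mathbf{x}\in2B,\ |\beta|=2}\Vert\partial_\beta\mathbf{f}(\mathbf{x})\Vert,\] the set \[\mathfrak{S}''_{\mathbf{f}}(\delta,\mathbf{a})=\{\mathbf{x}\in\mathbf{U}:\exists a_0\in\mathbb{Z}\text{ with }|a_0+\mathbf{f}(\mathbf{x})\mathbf{a}^\top|<\delta,\ \Vert\nabla\mathbf{f}(\mathbf{x})\mathbf{a}^\top\Vert\ge r^{-1}\}\] satisfies $\mathcal{L}_d(\mathfrak{S}''_{\mathbf{f}}(\delta,\mathbf{a})\cap B)\le C_{l,d}\,\delta\,\mathcal{L}_d(B)$, where $C_{l,d}>0$ depends only on $l$ and $d$.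
   Context: $\Vert\cdot\Vert$ is the sup norm, $\mathcal{L}_d$ Lebesgue measure. For a ball $B$ of centre $\mathbf{c}$ and radius $r$, $2B$ is the ball of centre $\mathbf{c}$ and radius $2r$. $\partial_\beta$ denotes the partial derivative for the multi-index $\beta$ (applied coordinatewise to $\mathbf{f}$). $\mathbf{f}(\mathbf{x})\mathbf{a}^\top=\sum_ia_if_i(\mathbf{x})$ where $\mathbf{f}=(f_1,\dots,f_n)$, and $\nabla\mathbf{f}(\mathbf{x})\mathbf{a}^\top$ is its gradient. $\mathbf{f}$ is $l$-nondegenerate at $\mathbf{x}_0$ if it is $C^l$ near $\mathbf{x}_0$ and its partial derivatives at $\mathbf{x}_0$ of orders $1,\dots,l$ span $\mathbb{R}^n$ (so $L$ is finite; the paper notes one may assume $L\neq0$). *)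

(* Defs.v *)
From HB Require Import structures.
From mathcomp Require Import all_boot all_order all_algebra.
From mathcomp Require Import all_classical all_reals all_analysis.
From mathcomp Require Import measurable_realfun.

Set Implicit Arguments.
Unset Strict Implicit.
Unset Printing Implicit Defensive.

Import Order.TTheory GRing.Theory Num.Theory.
Import numFieldNormedType.Exports.

Local Open Scope classical_set_scope.
Local Open Scope ring_scope.

(* Vectors of R^d are row vectors 'rV[R]_d; the library's norm on them is the
   sup norm, and [ball c r] is the corresponding open ball. A map on an open
   set U is represented by a total function; only its values on U matter. *)

Definition partial (R : realType) (d : nat) (W : normedModType R) (i : 'I_d)
    (g : 'rV[R]_d -> W) : 'rV[R]_d -> W :=
  fun x => 'D_(delta_mx 0 i) g x.

(* d_beta = d_0^(beta 0) ... d_(d-1)^(beta (d-1)). *)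
Definition mpartial (R : realType) (d : nat) (W : normedModType R)
    (beta : 'I_d -> nat) (g : 'rV[R]_d -> W) : 'rV[R]_d -> W :=
  foldr (fun i h => iter (beta i) (partial i) h) g (enum 'I_d).

(* All iterated partial derivatives of order at most k, taken in any order of
   the variables, exist and are continuous on the open set A. *)
Fixpoint C_on (R : realType) (d : nat) (W : normedModType R) (k : nat)
    (A : set 'rV[R]_d) (g : 'rV[R]_d -> W) : Prop :=
  (forall x, A x -> {for x, continuous g}) /\
  if k is k'.+1 then
    forall i : 'I_d,
      (forall x, A x -> derivable g x (delta_mx 0 i)) /\ C_on k' A (partial i g)
  else True.

Definition C_near (R : realType) (d : nat) (W : normedModType R) (k : nat)
    (g : 'rV[R]_d -> W) (x0 : 'rV[R]_d) : Prop :=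
  exists2 A : set 'rV[R]_d, open_nbhs x0 A & C_on k A g.

(* Multi-indices of order at most l have all entries at most l, so they are
   enumerated by the finite type {ffun 'I_d -> 'I_l.+1}. *)
Definition l_nondegenerate (R : realType) (d n l : nat)
    (f : 'rV[R]_d -> 'rV[R]_n) (x0 : 'rV[R]_d) : Prop :=
  C_near l f x0 /\
  (<<[seq mpartial (fun i => beta i : nat) f x0
       | beta : {ffun 'I_d -> 'I_l.+1} <- enum {ffun 'I_d -> 'I_l.+1}
       & (1 <= \sum_i (beta i : nat) <= l)%N]>> = fullv)%VS.

Definition grad (R : realType) (d : nat) (g : 'rV[R]_d -> R) (x : 'rV[R]_d) :
    'rV[R]_d :=
  \row_i partial i (g : 'rV[R]_d -> R^o) x.

(* Lebesgue measure on R^d as the d-fold product of the library's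
   one-dimensional Lebesgue measure: each step unfolds the library's product
   measure, (m1 \x m2) A = \int[m1]_t m2 (xsection A t). It is only
   applied to Borel sets. *)
Fixpoint lebesgue_rV (R : realType) (d : nat) : set 'rV[R]_d -> \bar R :=
  match d return set 'rV[R]_d -> \bar R with
  | 0 => fun A => (\1_A 0)%:E
  | d'.+1 => fun A =>
      (\int[@lebesgue_measure R]_t
         lebesgue_rV [set y : 'rV[R]_d' | A (row_mx (t%:M : 'rV[R]_1) y)])%E
  end.

Lemma lebesgue_rV_ball (R : realType) d (c : 'rV[R]_d) (r : R) : 0 < r ->
  lebesgue_rV (ball c r) = ((2 * r) ^+ d)%:E.
Proof.
move=> r0; elim: d c => [|d IH] c.
  rewrite /= expr0 indicE; congr ((_ : R)%:E).
  rewrite mem_set //; split => // i [].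
  by [].
have slice (t : R) : [set y : 'rV[R]_d | ball c r (row_mx (t%:M : 'rV[R]_1) y)]
  = if `[< ball (c 0 0) r t >] then ball (rsubmx (c : 'rV_(1+d))) r else set0.
  have E0 (y : 'rV[R]_d) : (row_mx (t%:M : 'rV[R]_1) y) 0 (0 : 'I_d.+1) = t.
    have -> : (0 : 'I_d.+1) = lshift d (0 : 'I_1) by apply: val_inj.
    by rewrite row_mxEl mxE eqxx mulr1n.
  have E1 (y : 'rV[R]_d) j : (row_mx (t%:M : 'rV[R]_1) y) 0 (rshift 1 j) = y 0 j.
    by rewrite row_mxEr.
  case: asboolP => ct; apply/seteqP; split => y //=.
  - move=> [_ H]; split=> // i j; rewrite ord1; move: (H 0 (rshift 1 j)).
    by rewrite E1 mxE.
  - move=> [_ H]; split=> // i j; rewrite ord1.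
    case: (unliftP 0 j) => [k|] -> ; last by rewrite E0.
    have -> : lift 0 k = rshift 1 k by apply: val_inj.
    by move: (H 0 k); rewrite E1 mxE.
  - by move=> [_ H]; apply: ct; move: (H 0 0); rewrite E0.
rewrite /=.
transitivity (\int[@lebesgue_measure R]_t (((2 * r) ^+ d)%:E * (\1_(ball (c 0 0) r) t)%:E))%E.
  apply: eq_integral => t _; rewrite slice indicE.
  case: asboolP => ct; first by rewrite IH mem_set // mule1.
  rewrite memNset // mule0.
  clear; elim: d => [|d IHd] /=; first by rewrite indicE in_set0.
  by rewrite integral0_eq // => x _; exact: IHd.
rewrite ge0_integralZl//=; last 2 first.
- by apply/measurable_realfun.measurable_EFinP; apply: measurable_indic; exact: measurable_ball.
- by rewrite lee_fin exprn_ge0 // mulr_ge0 // ltW.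
rewrite integral_indic //; last exact: measurable_ball.
rewrite setIT.
transitivity (((2 * r) ^+ d)%:E * (r *+ 2)%:E)%E.
  by congr (_ * _)%E; exact: (@lebesgue_measure_ball R (c 0 0) r (ltW r0)).
rewrite -EFinM exprSr.
by congr ((_ * _)%:E); rewrite mulr_natl.
Qed.

(* f(x) a^T *)
Definition lin_form (R : realType) (d n : nat) (f : 'rV[R]_d -> 'rV[R]_n)
    (a : 'rV[R]_n) : 'rV[R]_d -> R :=
  fun x => (f x *m a^T) 0 0.

(* L for the ball B of centre c and radius r, as an extended real: with the
   library's convention 0^-1 = +oo in \bar R, no vector a has norm at least
   1 / (4 n L r^2) when L = 0. *)
Definition sup_partial2 (R : realType) (d n : nat) (f : 'rV[R]_d -> 'rV[R]_n)
    (c : 'rV[R]_d) (r : R) : \bar R :=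
  ereal_sup [set y | exists x (beta : 'I_d -> nat),
    [/\ ball c (2 * r) x, (\sum_i beta i)%N = 2%N &
        y = `|mpartial beta f x|%:E]].

Definition Sfrak2 (R : realType) (d n : nat) (U : set 'rV[R]_d)
    (f : 'rV[R]_d -> 'rV[R]_n) (r delta : R) (a : 'rV[R]_n) : set 'rV[R]_d :=
  [set x | [/\ U x,
     exists a0 : int, `|a0%:~R + lin_form f a x| < delta &
     r^-1 <= `|grad (lin_form f a) x|]].

(* Main.v *)
Require Import Defs.
From HB Require Import structures.
From mathcomp Require Import all_boot all_order all_algebra.
From mathcomp Require Import all_classical all_reals all_analysis.
From mathcomp Require Import measurable_realfun ring lra zify.

(* Let [g = f a^T]. By nondegeneracy some partial derivative of [g] at [x0], of
   order [k] with 1 <= k <= l, is comparable to [|a|]. Polarisation along integer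
   directions yields [w0] and [w_i = w0 + s_i e_i], with entries bounded in terms
   of [l], such that the k-th derivative of [g] along each of them is nearly
   constant and nonzero on a ball around [x0] that does not depend on [a]. Where
   the gradient is at least 1/r, the derivative of [g] along one of these
   directions [w] is at least 1/(2r). On a segment [x + s r w], 0 <= s <= 1, the
   function [h s = g (x + s r w)] satisfies |h'| >= 1/2 at such points, and h'
   either varies by a factor at most 3 (k = 1) or is piecewise monotone with a
   number of pieces bounded in terms of [k] (k >= 2); on each piece the set where
   [h] is [delta]-close to an integer has measure O(delta). Averaging over the
   translates by [s r w] and exchanging integrals turns this into the bound on
   R^d. *)

Set Implicit Arguments.
Unset Strict Implicit.
Unset Printing Implicit Defensive.

Import Order.TTheory GRing.Theory Num.Theory.
Import numFieldNormedType.Exports.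

Local Open Scope classical_set_scope.
Local Open Scope ring_scope.

(** No upper bound on [h'] holds uniformly in [a], so [h] may pass arbitrarily many integers on a
    segment. What saves the estimate is that on each piece, up to sign and reflection, [h'] never
    falls below a third of an earlier value: the lengths between integers then pay for the
    neighbourhoods of the integers. Uniformity in [a] is homogeneity: the lower bound at [x0] and
    the variation of the derivatives near [x0] are both proportional to [|a|], so one radius serves
    all [a]. The directions may depend on [a], but only their number and their size enter the
    constant. Each [w_i] is paired with [w0] because [w_i - w0] is a positive multiple of [e_i]: a
    large i-th partial derivative forces a large derivative along [w0] or along [w_i]. On the line,
    measure is replaced by finite covers by intervals, which can be restricted, reflected and added
    without measurability of the intermediate sets. *)

(** * Sets of reals where a steep function is close to an integer *)

(* The members of [s] are pairs (centre, radius). *)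
Definition covered (R : realType) (S : set R) (X : R) : Prop :=
  exists s : seq (R * R),
    [/\ forall x, S x -> exists2 b, b \in s & `|x - b.1| <= b.2,
        forall b, b \in s -> 0 <= b.2 &
        \sum_(b <- s) 2 * b.2 <= X].

Definition near_int (R : realType) (delta y : R) : Prop :=
  exists a0 : int, `|a0%:~R + y| < delta.

Section Covers.
Variable R : realType.
Implicit Types (S T : set R) (X Y : R).

Lemma covered_sub S T X Y : S `<=` T -> X <= Y -> covered T X -> covered S Y.
Proof.
move=> ST XY [s [sT s0 sX]]; exists s; split=> //; last exact: le_trans XY.
by move=> x /ST/sT.
Qed.

Lemma coveredU S T X Y :
  covered S X -> covered T Y -> covered (S `|` T) (X + Y).
Proof.
move=> [s [sS s0 sX]] [t [tT t0 tY]]; exists (s ++ t); split.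
- move=> x [/sS|/tT] [b bs xb]; exists b => //; rewrite mem_cat bs ?orbT //.
- by move=> b; rewrite mem_cat => /orP[/s0|/t0].
- by rewrite big_cat lerD.
Qed.

Lemma covered_diam S (D : R) : 0 <= D ->
  (forall x y, S x -> S y -> `|x - y| <= D) -> covered S (2 * D).
Proof.
move=> D0 SD; have [[c Sc]|S0] := pselect (exists c, S c).
  exists [:: (c, D)]; split.
  - by move=> x Sx; exists (c, D); rewrite ?inE // SD.
  - by move=> b; rewrite inE => /eqP ->.
  - by rewrite big_seq1.
exists [::]; split=> //.
- by move=> x Sx; exfalso; apply: S0; exists x.
- by rewrite big_nil mulr_ge0.
Qed.

Lemma covered_opp S X : covered S X -> covered [set x | S (- x)] X.
Proof.
move=> [s [sS s0 sX]]; exists [seq (- b.1, b.2) | b <- s]; split.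
- move=> x /= /sS [b bs xb]; exists (- b.1, b.2).
    by apply/mapP; exists b.
  by rewrite /= opprK -normrN opprD.
- by move=> b /mapP[b' /s0 b0 ->].
- by rewrite big_map.
Qed.

(** [S] need not contain its infimum and supremum. Points [p], [q] of [S] within [e] of them leave
    two end pieces of diameter at most [e], each of cost [2 * e]. *)
Lemma covered_exhaust S X (e : R) : 0 < e -> 0 <= X ->
  (forall x y, S x -> S y -> `|x - y| <= 1) ->
  (forall p q, S p -> S q -> p <= q -> covered (S `&` [set x | p <= x <= q]) X) ->
  covered S (X + 4 * e).
Proof.
move=> e0 X0 S1 SX; have [[c Sc]|Sn] := pselect (exists c, S c); last first.
  exists [::]; split=> //; first by move=> x Sx; exfalso; apply: Sn; exists x.
  by rewrite big_nil addr_ge0 // mulr_ge0 // ltW.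
have hi : has_inf S.
  split; first by exists c.
  by exists (c - 1) => x Sx; have := S1 _ _ Sx Sc; rewrite ler_norml; lra.
have hs : has_sup S.
  split; first by exists c.
  by exists (c + 1) => x Sx; have := S1 _ _ Sx Sc; rewrite ler_norml; lra.
have [p Sp pi] := inf_adherent e0 hi.
have [q Sq qs] := sup_adherent e0 hs.
have [p' [q' [Sp' Sq' pq [pi' qs']]]] : exists p' q', [/\ S p', S q', p' <= q' &
    p' < inf S + e /\ sup S - e < q'].
  by case: (leP p q) => pq; [exists p, q|exists q, p]; split=> //; try split; lra.
have lo x : S x -> inf S <= x by apply: ge_inf; case: hi.
have up x : S x -> x <= sup S by apply: ub_le_sup; case: hs.
have c1 : covered [set x | S x /\ x < p'] (2 * e).
  apply: covered_diam; first exact: ltW.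
  move=> x y [/lo xi xp] [/lo yi yp]; rewrite ler_norml; lra.
have c2 : covered [set x | S x /\ q' < x] (2 * e).
  apply: covered_diam; first exact: ltW.
  move=> x y [/up xi xp] [/up yi yp]; rewrite ler_norml; lra.
apply: (covered_sub _ _ (coveredU (SX _ _ Sp' Sq' pq) (coveredU c1 c2))); last first.
  by lra.
move=> x Sx; case: (ltP x p') => xp; first by right; left.
case: (ltP q' x) => xq; first by right; right.
by left; split=> //=; rewrite xp xq.
Qed.

End Covers.

Section NearIntegers.
Variable R : realType.
Implicit Types (h : R -> R) (S : set R).

(** As [delta <= 2^-1] and the values of [h] lie in a unit window, only three integers can be close.
    For each of them the expansion bounds the diameter by [2 * delta / mu], hence the cost by
    [4 * delta / mu]. *)
Lemma near_int_expanding S h (mu delta y0 : R) : 0 < mu -> 0 < delta <= 2^-1 ->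
  (forall s t, S s -> S t -> s <= t -> mu * (t - s) <= h t - h s) ->
  (forall s, S s -> y0 <= h s <= y0 + 1) ->
  covered [set s | S s /\ near_int delta (h s)] (12 * delta / mu).
Proof.
move=> mu0 /andP[d0 d1] hmu hy.
have one (k : int) :
    covered [set s | S s /\ `|k%:~R + h s| < delta] (2 * (2 * delta / mu)).
  apply: covered_diam; first by rewrite divr_ge0 // ?mulr_ge0 // ltW.
  move=> x y [Sx]; rewrite ltr_norml => kx [Sy]; rewrite ltr_norml => ky.
  rewrite ler_pdivlMr //.
  case: (leP x y) => xy.
    have := hmu _ _ Sx Sy xy; rewrite distrC ger0_norm ?subr_ge0 // mulrC; lra.
  have := hmu _ _ Sy Sx (ltW xy); rewrite ger0_norm ?subr_ge0 ?(ltW xy) // mulrC; lra.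
pose K := Num.floor (- y0).
have /andP[K1 K2] : K%:~R <= - y0 < (K + 1)%:~R.
  exact: floor_itv.
apply: (covered_sub _ _ (coveredU (one (K - 1)) (coveredU (one K) (one (K + 1))))).
  move=> s [Ss [k hk]].
  have /andP[hy1 hy2] := hy _ Ss.
  have hk' := hk; move: hk'; rewrite ltr_norml => /andP[k1 k2].
  rewrite intrD in K2.
  have k3 : k < K + 2 by rewrite -(@ltr_int R) intrD; lra.
  have k4 : K - 2 < k by rewrite -(@ltr_int R) intrB; lra.
  have [E|[E|E]] : k = K - 1 \/ (k = K \/ k = K + 1) by lia.
  - by left; split=> //; rewrite -E.
  - by right; left; split=> //; rewrite -E.
  - by right; right; split=> //; rewrite -E.
rewrite le_eqVlt; apply/orP; left; apply/eqP; field; lra.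
Qed.

Lemma MVT_le h (h' : R -> R) (p q : R) : p <= q ->
  (forall s, p <= s <= q -> is_derive s 1 h (h' s)) ->
  exists2 c, p <= c <= q & h q - h p = h' c * (q - p).
Proof.
move=> pq dh; have [c cpq E] : exists2 c, c \in `[p, q]%R & h q - h p = h' c * (q - p).
  apply: (@MVT_segment R) => //.
    by move=> x; rewrite in_itv /= => /andP[px xq]; apply: dh; rewrite !ltW.
  apply: derivable_within_continuous => x; rewrite in_itv /= => /dh dx.
  exact: (@ex_derive _ _ _ _ _ _ _ dx).
by exists c => //; move: cpq; rewrite in_itv.
Qed.

Lemma near_int_unit (delta : R) h (h' : R -> R) (p q : R) : 0 < delta <= 2^-1 ->
  p <= q -> (forall s, p <= s <= q -> is_derive s 1 h (h' s)) ->
  (forall s, p <= s <= q -> 0 < h' s) ->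
  (forall s, p <= s <= q -> h' p <= 3 * h' s) -> h q - h p <= 1 ->
  covered [set s | p <= s <= q /\ near_int delta (h s)] (36 * delta / h' p).
Proof.
move=> dd pq dh h0 h3 hq.
have hp : 0 < h' p by apply: h0; rewrite lexx pq.
have incr (s t : R) : p <= s <= q -> p <= t <= q -> s <= t ->
    h' p / 3 * (t - s) <= h t - h s.
  move=> /andP[s1 s2] /andP[t1 t2] st.
  have [|c /andP[c1 c2] ->] := @MVT_le h h' s t st.
    by move=> u /andP[? ?]; apply: dh; lra.
  by rewrite ler_wpM2r ?subr_ge0 // ler_pdivrMr // mulrC h3 //; lra.
have mono (s t : R) : p <= s <= q -> p <= t <= q -> s <= t -> h s <= h t.
  move=> sp tp st; rewrite -subr_ge0; apply: le_trans (incr s t sp tp st).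
  by rewrite mulr_ge0 ?subr_ge0 // divr_ge0 // ltW.
apply: (covered_sub _ _ (@near_int_expanding [set s | p <= s <= q] h (h' p / 3)
  delta (h p) _ dd _ _)) => //=.
- rewrite le_eqVlt; apply/orP; left; apply/eqP; field; lra.
- by rewrite divr_gt0.
- move=> s spq; have /andP[s1 s2] := spq.
  have := mono p s _ spq s1; have := mono s q spq _ s2; rewrite pq !lexx; lra.
Qed.

(* The first unit of values of [h] costs [delta / h' p]; in each later unit the
   cost [delta / h' p'] is paid for by the length [p' - p >= 1 / (3 h' p')] of
   the preceding one. *)
Lemma near_int_segment (delta : R) h (h' : R -> R) (N : nat) : 0 < delta <= 2^-1 ->
  forall p q : R, p <= q ->
  (forall s, p <= s <= q -> is_derive s 1 h (h' s)) ->
  (forall s, p <= s <= q -> 0 < h' s) ->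
  (forall s t, p <= s -> s <= t -> t <= q -> h' s <= 3 * h' t) ->
  h q - h p <= N.+1%:R ->
  covered [set s | p <= s <= q /\ near_int delta (h s)]
    (36 * delta / h' p + 108 * delta * (q - p)).
Proof.
move=> dd; have /andP[d0 d1] := dd.
(* [N] only bounds the number of units of values left to treat, so that the recursion ends; the cost
   is independent of it. *)
elim: N => [|N IH] p q pq dh h0 h3 hN.
  apply: (covered_sub _ _ (near_int_unit dd pq dh h0 _ hN)) => //.
    by rewrite lerDl !mulr_ge0 ?subr_ge0 // ltW.
  by move=> s /andP[? ?]; apply: h3 => //; lra.
case: (leP (h q - h p) 1) => hq1.
  apply: (covered_sub _ _ (near_int_unit dd pq dh h0 _ hq1)) => //.
    by rewrite lerDl !mulr_ge0 ?subr_ge0 // ltW.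
  by move=> s /andP[? ?]; apply: h3 => //; lra.
have [p' pp' hp'] : exists2 c, c \in `[p, q]%R & h c = h p + 1.
  apply: IVT => //.
    apply: derivable_within_continuous => x; rewrite in_itv /= => /dh dx.
    exact: (@ex_derive _ _ _ _ _ _ _ dx).
  by rewrite ge_min le_max; lra.
move: pp'; rewrite in_itv /= => pp'; have /andP[p1 p2] := pp'.
have c1 : covered [set s | p <= s <= p' /\ near_int delta (h s)] (36 * delta / h' p).
  apply: near_int_unit => //.
  - by move=> s /andP[? ?]; apply: dh; lra.
  - by move=> s /andP[? ?]; apply: h0; lra.
  - by move=> s /andP[? ?]; apply: h3 => //; lra.
  - by rewrite hp' addrAC subrr add0r.
have c2 := IH p' q p2; have hp'0 : 0 < h' p' by apply: h0.
apply: (covered_sub _ _ (coveredU c1 (c2 _ _ _ _))).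
- move=> s [/andP[s1 s2] hs]; case: (leP s p') => sp; [left|right]; split=> //.
    by rewrite s1.
  by rewrite (ltW sp).
(* [h] gains exactly 1 on [[p, p']], so the mean value theorem bounds [p' - p] from below; this
   converts [36 * delta / h' p'] into [108 * delta * (p' - p)]. *)
- have [|c /andP[e1 e2] E] := @MVT_le h h' p p' p1.
    by move=> w /andP[? ?]; apply: dh; lra.
  have E2 : 1 <= 3 * h' p' * (p' - p).
    have {1}-> : 1 = h p' - h p by lra.
    by rewrite E ler_wpM2r ?subr_ge0 // h3 //; lra.
  have E3 : (h' p')^-1 <= 3 * (p' - p).
    by rewrite -div1r ler_pdivrMr // mulrAC.
  have : 36 * delta / h' p' <= 36 * delta * (3 * (p' - p)).
    by rewrite ler_wpM2l // mulr_ge0 // ltW.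
  lra.
- by move=> s /andP[? ?]; apply: dh; lra.
- by move=> s /andP[? ?]; apply: h0; lra.
- by move=> s t ? ? ?; apply: h3 => //; lra.
- by move: hN; rewrite -[N.+2]addn1 natrD hp'; lra.
Qed.

(** The segment bound needs end points, which an interval may lack. [covered_exhaust] with
    [e = delta] supplies them and raises 108 to 112. *)
Lemma near_int_interval S (delta mu : R) h (h' : R -> R) :
  0 < delta <= 2^-1 -> 0 < mu -> is_interval S ->
  (forall x y, S x -> S y -> `|x - y| <= 1) ->
  (forall s, S s -> is_derive s 1 h (h' s)) ->
  (forall s, S s -> mu <= h' s) ->
  (forall s t, S s -> S t -> s <= t -> h' s <= 3 * h' t) ->
  covered [set s | S s /\ near_int delta (h s)]
    (36 * delta / mu + 112 * delta).
Proof.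
move=> dd mu0 iS S1 dh hmu h3; have /andP[d0 _] := dd.
have -> : 36 * delta / mu + 112 * delta = (36 * delta / mu + 108 * delta) + 4 * delta.
  by lra.
apply: covered_exhaust => //.
- by rewrite addr_ge0 ?divr_ge0 ?mulr_ge0 // ltW.
- by move=> x y [Sx _] [Sy _]; apply: S1.
move=> p q [Sp _] [Sq _] pq.
have pqS s : p <= s <= q -> S s by apply: iS.
apply: (covered_sub _ _ (@near_int_segment delta h h' (Num.truncn (h q - h p)) dd p q pq
   _ _ _ _)).
- by move=> s [[Ss sn] spq].
- apply: lerD.
    apply: ler_wpM2l; first by rewrite mulr_ge0 // ltW.
    by rewrite lef_pV2 ?posrE ?hmu // (lt_le_trans mu0) ?hmu.
  rewrite ger_pMr ?mulr_gt0 //; have := S1 _ _ Sq Sp; rewrite ger0_norm ?subr_ge0 //.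
- by move=> s /pqS/dh.
- by move=> s /pqS/hmu; apply: lt_le_trans.
- move=> s t ps st tq; apply: h3 => //; apply: pqS; lra.
- apply: ltW; exact: truncnS_gt.
Qed.

End NearIntegers.

Section NonvanishingDerivative.
Variable R : realType.
Implicit Types (u : nat -> R -> R) (S : set R).

(** [u] stands for a function and its successive derivatives; that [u i.+1] is the derivative of
    [u i] is a hypothesis of the lemmas below. *)
Definition steep_near_int S (delta : R) u : set R :=
  [set s | S s /\ 2^-1 <= `|u 1%N s| /\ near_int delta (u 0%N s)].

Lemma near_int_opp (delta y : R) : near_int delta y -> near_int delta (- y).
Proof.
by move=> [a ha]; exists (- a); rewrite -normrN opprD opprK intrN opprK.
Qed.

Lemma steep_near_int_opp S (delta : R) u :
  steep_near_int S delta u `<=` steep_near_int S delta (fun i s => - u i s).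
Proof.
by move=> s [Ss [su sn]]; do !split=> //=; rewrite ?normrN //; exact: near_int_opp.
Qed.

(** The form [?= iff] also yields injectivity, from which a derivative is seen to vanish at most
    once. *)
Lemma derive_pos_increasing S (h h' : R -> R) : is_interval S ->
  (forall s, S s -> is_derive s 1 h (h' s)) -> (forall s, S s -> 0 < h' s) ->
  forall s t, S s -> S t -> s <= t -> h s <= h t ?= iff (s == t).
Proof.
move=> iS dh h0 s t Ss St st.
have sub r : s <= r <= t -> S r by apply: iS.
have [|c cst E] := @MVT_le _ h h' s t st; first by move=> r /sub/dh.
have hc := h0 _ (sub _ cst).
split; first by rewrite -subr_ge0 E mulr_ge0 ?subr_ge0 // ltW.
by rewrite eq_sym -subr_eq0 E mulf_eq0 gt_eqF //= subr_eq0 eq_sym.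
Qed.

(** Since [u 1] increases, the steep points form two intervals, [u 1 >= 1/2] and [u 1 <= -1/2].
    Reflecting [s] to [- s] makes the second like the first. Each costs [36 * 2 + 112 = 184] times
    [delta]. *)
Lemma steep_near_int_monotone S (delta : R) u :
  0 < delta <= 2^-1 -> is_interval S ->
  (forall x y, S x -> S y -> `|x - y| <= 1) ->
  (forall i, (i < 2)%N -> forall s, S s -> is_derive s 1 (u i) (u i.+1 s)) ->
  (forall s, S s -> 0 < u 2%N s) ->
  covered (steep_near_int S delta u) (368 * delta).
Proof.
move=> dd iS S1 du u2; have /andP[d0 _] := dd.
have incr s t : S s -> S t -> s <= t -> u 1%N s <= u 1%N t.
  move=> Ss St st.
  by have [] := derive_pos_increasing iS (du 1%N isT) u2 Ss St st.
have cp : covered [set s | (S s /\ 2^-1 <= u 1%N s) /\ near_int delta (u 0%N s)]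
    (36 * delta / 2^-1 + 112 * delta).
  apply: (@near_int_interval R _ delta 2^-1 (u 0%N) (u 1%N)) => //.
  - move=> x y [Sx ux] [Sy uy] z xzy; have Sz := iS _ _ Sx Sy _ xzy.
    by split=> //; apply: le_trans ux (incr _ _ _ _ _) => //; case/andP: xzy.
  - by move=> x y [Sx _] [Sy _]; apply: S1.
  - by move=> s [Ss _]; apply: (du 0%N).
  - by move=> s [].
  - by move=> s t [Ss us] [St ut] st; have := incr _ _ Ss St st; lra.
have cm : covered [set s | (S (- s) /\ 2^-1 <= - u 1%N (- s)) /\
      near_int delta (u 0%N (- s))] (36 * delta / 2^-1 + 112 * delta).
  apply: (@near_int_interval R _ delta 2^-1 (fun s => u 0%N (- s))
    (fun s => - u 1%N (- s))) => //.
  - move=> x y [Sx ux] [Sy uy] z xzy; have Sz : S (- z).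
      by apply: (iS _ _ Sy Sx); rewrite !lerN2 andbC.
    split=> //; apply: le_trans ux _; rewrite lerN2; apply: incr => //.
    by rewrite lerN2; case/andP: xzy.
  - by move=> x y [Sx _] [Sy _]; rewrite -normrN opprD S1.
  - move=> s [Ss _]; have d1 := du 0%N isT _ Ss.
    have d2 : is_derive s 1 (-%R : R -> R) (- 1) by apply: is_deriveNid.
    have := @is_derive1_comp _ (u 0%N) -%R s _ _ d1 d2.
    by rewrite mulrN1.
  - by move=> s [].
  - move=> s t [Ss us] [St ut] st.
    have := incr _ _ St Ss; rewrite lerN2 => /(_ st); lra.
apply: (covered_sub _ _ (coveredU cp (covered_opp cm))); last by lra.
move=> s [Ss [us sn]]; move: us; rewrite ler_normr => /orP[us|us]; first by left.
by right; rewrite /= opprK.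
Qed.

(* If [u m.+3] does not vanish, then [u m.+2] is strictly monotone and vanishes
   at most once, so the bound doubles with each further derivative. *)
Lemma steep_near_int_pos (delta : R) (m : nat) : 0 < delta <= 2^-1 ->
  forall S u, is_interval S -> (forall x y, S x -> S y -> `|x - y| <= 1) ->
  (forall i, (i < m.+2)%N -> forall s, S s -> is_derive s 1 (u i) (u i.+1 s)) ->
  (forall s, S s -> 0 < u m.+2 s) ->
  covered (steep_near_int S delta u) (368 * 2 ^+ m * delta).
Proof.
move=> dd; elim: m => [|m IH] S u iS S1 du um.
  by rewrite expr0 mulr1; apply: steep_near_int_monotone.
have incr s t : S s -> S t -> s <= t -> u m.+2 s <= u m.+2 t ?= iff (s == t).
  by move=> Ss St st; apply: (derive_pos_increasing iS (du m.+2 _) um).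
have c1 : covered (steep_near_int [set s | S s /\ 0 < u m.+2 s] delta u)
    (368 * 2 ^+ m * delta).
  apply: IH => //.
  - move=> x y [Sx ux] [Sy uy] z xzy; have Sz := iS _ _ Sx Sy _ xzy.
    split=> //; apply: lt_le_trans ux _.
    by have /andP[xz _] := xzy; case: (incr _ _ Sx Sz xz).
  - by move=> x y [Sx _] [Sy _]; apply: S1.
  - by move=> i im s [Ss _]; apply: du => //; rewrite ltnS ltnW.
  - by move=> s [].
have c2 : covered (steep_near_int [set s | S s /\ u m.+2 s < 0] delta u)
    (368 * 2 ^+ m * delta).
  apply: (covered_sub (@steep_near_int_opp _ _ _) (lexx _)).
  apply: IH => //.
  - move=> x y [Sx ux] [Sy uy] z xzy; have Sz := iS _ _ Sx Sy _ xzy.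
    split=> //; apply: le_lt_trans uy.
    by have /andP[_ zy] := xzy; case: (incr _ _ Sz Sy zy).
  - by move=> x y [Sx _] [Sy _]; apply: S1.
  - move=> i im s [Ss _]; apply: is_deriveN; apply: du => //.
    by rewrite ltnS ltnW.
  - by move=> s [Ss us]; rewrite oppr_gt0.
(* At most one point, covered at no cost by an interval of radius 0. *)
have c3 : covered [set s | S s /\ u m.+2 s = 0] (2 * 0).
  apply: covered_diam => // x y [Sx ux] [Sy uy].
  wlog xy : x y Sx Sy ux uy / x <= y => [H|].
    by case: (leP x y) => [|/ltW] xy; [|rewrite distrC]; apply: H.
  have [_] := incr _ _ Sx Sy xy.
  by rewrite ux uy eqxx => /esym/eqP ->; rewrite subrr normr0.
apply: (covered_sub _ _ (coveredU c1 (coveredU c2 c3))); last first.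
  by rewrite mulr0 addr0 exprS; lra.
move=> s [Ss us]; case: (ltgtP (u m.+2 s) 0) => u0.
- by right; left.
- by left.
- by right; right.
Qed.

Lemma steep_near_int_covered S (delta q : R) (k : nat) u :
  0 < delta -> (0 < k)%N -> is_interval S ->
  (forall x y, S x -> S y -> `|x - y| <= 1) ->
  (forall i, (i < k)%N -> forall s, S s -> is_derive s 1 (u i) (u i.+1 s)) ->
  q != 0 -> (forall s, S s -> `|u k s - q| <= `|q| / 2) ->
  covered (steep_near_int S delta u) (368 * 2 ^+ k * delta).
Proof.
move=> d0 k0 iS S1 du q0 uq.
wlog {q0} qp : u q du uq / 0 < q.
  move=> H; case: (ltgtP q 0) q0 => // qs _; last by apply: (H u q).
  apply: (covered_sub (@steep_near_int_opp _ _ _) (lexx _)).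
  apply: (H (fun i s => - u i s) (- q)) => //; last by rewrite oppr_gt0.
    by move=> i ik s Ss; apply: is_deriveN; apply: du.
  by move=> s Ss; rewrite -opprD !normrN uq.
have {}uq s : S s -> q / 2 <= u k s <= 3 * (q / 2).
  by move=> /uq; rewrite (gtr0_norm qp) ler_norml; lra.
have two1 i : 1 <= 2 ^+ i :> R by apply: exprn_ege1; lra.
(* For [delta > 1/2] every real may be close to an integer, but [S] has diameter at most 1 and the
   claimed bound exceeds the cost 2 of covering all of it. *)
case: (leP delta 2^-1) => d1; last first.
  apply: (covered_sub (T := S) (X := 2 * 1) _ _ (covered_diam ler01 S1)) => //.
    by move=> s [].
  have := two1 k; have : delta * 1 <= delta * 2 ^+ k by rewrite ler_pM2l.
  by lra.
have dd : 0 < delta <= 2^-1 by rewrite d0.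
case: k k0 du uq => [//|[_ du uq|m _ du uq]].
  (* For [k = 1], [u 1] stays between [q / 2] and [3 * q / 2], whence the factor 3. One steep point
     gives [3 * q / 2 >= 1/2], so [u 1 >= q / 2 >= 1/6] on all of [S]. *)
  have [[s0 [Ss0 [us0 _]]]|E0] := pselect (exists s, steep_near_int S delta u s);
    last first.
    apply: (covered_sub (T := set0) (X := 2 * 0) _ _ (covered_diam _ _)) => //.
      by move=> s ss; apply: E0; exists s.
    by rewrite mulr0 !mulr_ge0 // ltW.
  apply: (covered_sub _ _ (@near_int_interval R S delta 6^-1 (u 0%N) (u 1%N) dd
    _ iS S1 (du 0%N isT) _ _)).
  - by move=> s [Ss [_ sn]].
  - by rewrite expr1; lra.
  - by lra.
  - move=> s Ss; have := uq _ Ss; have := uq _ Ss0.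
    by move: us0; rewrite ler_normr => /orP[]; lra.
  - by move=> s t Ss St _; have := uq _ Ss; have := uq _ St; lra.
apply: (covered_sub (fun _ => id) _ (@steep_near_int_pos delta m dd S u iS S1 du _)).
  rewrite ler_pM2r // ler_wpM2l // 2!exprS.
  by have := two1 m; lra.
by move=> s /uq /andP[us _]; apply: lt_le_trans us; lra.
Qed.

End NonvanishingDerivative.

(** * Directional and iterated partial derivatives *)

Lemma ler_dist_half (R : realFieldType) (x y z e : R) :
  `|x - z| < e / 2 -> `|y - z| < e / 2 -> `|x - y| <= e.
Proof.
move=> xz yz; rewrite (le_trans (ler_distD z _ _)) // (splitr e) lerD ?ltW //.
by rewrite distrC.
Qed.

Section DirectionalDerivatives.
Variables (R : realType) (V : normedModType R).
Implicit Types (g : V -> R^o) (A : set V) (x u v : V).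

Lemma is_derive_line (W : normedModType R) (g : V -> W) x v (s : R) (dg : W) :
  is_derive (x + s *: v) v g dg ->
  is_derive s 1 (fun t : R => g (x + t *: v)) dg.
Proof.
have E : (fun h : R => h^-1 *: (((fun t : R => g (x + t *: v)) \o shift s) (h *: 1) -
      g (x + s *: v))) =
    (fun h => h^-1 *: ((g \o shift (x + s *: v)) (h *: v) - g (x + s *: v))).
  apply/funext => h /=; congr (_ *: (g _ - _)).
  by rewrite /GRing.scale /= mulr1 [RHS]addrCA -scalerDl.
move=> [dg1 dg2]; split.
  by rewrite /derivable E.
by rewrite /derive E.
Qed.

Lemma MVT_line g x v (t : R) :
  (forall s : R, `|s| <= `|t| -> derivable g (x + s *: v) v) ->
  exists2 s : R, `|s| <= `|t| & g (x + t *: v) - g x = t * 'D_v g (x + s *: v).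
Proof.
move=> dg.
have dl (s : R) : `|s| <= `|t| ->
    is_derive s 1 (fun r => g (x + r *: v)) ('D_v g (x + s *: v)).
  by move=> /dg ds; apply: is_derive_line; apply: derivableP.
case: (leP 0 t) => t0.
  have [|c /andP[c0 ct]] := MVT_le t0
      (h := fun r => g (x + r *: v)) (h' := fun s => 'D_v g (x + s *: v)).
    by move=> s /andP[s0 st]; apply: dl; rewrite !ger0_norm // (le_trans s0).
  rewrite scale0r addr0 subr0 mulrC => E; exists c => //.
  by rewrite !ger0_norm // (le_trans c0).
have [|c /andP[c0 ct]] := MVT_le (ltW t0)
    (h := fun r => g (x + r *: v)) (h' := fun s => 'D_v g (x + s *: v)).
  by move=> s /andP[s0 st]; apply: dl; rewrite !ler0_norm ?lerN2 // ltW.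
rewrite scale0r addr0 sub0r mulrN => E; exists c.
  by rewrite !ler0_norm ?lerN2 // ltW.
by rewrite mulrC -opprB E opprK.
Qed.

(** The increment along [u + c *: v] is split into a leg along [u] and then a leg along [v]. The
    second starts at a moving point, so it is handled by the mean value theorem and the continuity
    of ['D_v g] at [x]; no total differentiability is assumed. *)
Lemma is_derive_add_dir g A x u v (c du : R) : open A -> A x ->
  is_derive x u g du -> (forall y, A y -> derivable g y v) ->
  {for x, continuous ('D_v g)} ->
  is_derive x (u + c *: v) g (du + c * 'D_v g x).
Proof.
move=> oA Ax [du1 du2] dv cv.
have key : (fun h : R => h^-1 * (g (h *: (u + c *: v) + x) - g (h *: u + x)))
    @ 0^' --> c * 'D_v g x.
  apply/cvgrPdist_lt => e e0.
  pose e' := e / (`|c| + 1).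
  have e'0 : 0 < e' by rewrite divr_gt0 // ltr_pwDr.
  have : \forall y \near x, A y /\ `|'D_v g x - 'D_v g y| < e'.
    apply: filterI; first exact: open_nbhs_nbhs.
    by move/cvgrPdist_lt : cv; apply.
  move=> /nbhs_ballP[rho /= rho0 Hrho].
  (* Every point of the second leg lies within [|h| * K] of [x]; the summand 1 keeps [K] positive,
     as it does for the denominator of [e']. *)
  pose K := `|u| + `|c| * `|v| + 1.
  have K0 : 0 < K by rewrite ltr_pwDr // addr_ge0 // mulr_ge0.
  have inb (h s : R) : `|h| < rho / K -> `|s| <= `|h * c| ->
      ball x rho (h *: u + x + s *: v).
    move=> hr sh; rewrite -ball_normE /= distrC.
    rewrite [_ - x]addrAC addrK (le_lt_trans (ler_normD _ _)) //.
    rewrite !normrZ (@le_lt_trans _ _ (`|h| * K)) //; last by rewrite -ltr_pdivlMr.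
    rewrite /K -addrA mulrDr lerD2l mulrDr mulr1.
    apply: (@le_trans _ _ (`|h * c| * `|v|)); first by rewrite ler_wpM2r.
    by rewrite normrM mulrA lerDl.
  have : \forall h \near (0 : R)^', h != 0 /\ `|h| < rho / K.
    apply: filterI; first exact: (@nbhs_dnbhs_neq R 0).
    apply: nbhs_dnbhs; have r0 : 0 < rho / K by rewrite divr_gt0.
    apply/nbhs_ballP; exists (rho / K) => //= h; rewrite -ball_normE /=.
    by rewrite sub0r normrN.
  apply: filterS => h [h0 hr].
  have [|s sh E] := @MVT_line g (h *: u + x) v (h * c).
    by move=> s sh; apply: dv; have [] := Hrho _ (inb _ _ hr sh).
  have -> : h *: (u + c *: v) + x = h *: u + x + (h * c) *: v.
    by rewrite scalerDr scalerA addrAC.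
  rewrite E !mulrA mulVf // mul1r -mulrBr normrM.
  have [_ hd] := Hrho _ (inb _ _ hr sh).
  have : `|c| * `|'D_v g x - 'D_v g (h *: u + x + s *: v)| <= `|c| * e'.
    by rewrite ler_wpM2l // ltW.
  move=> /le_lt_trans; apply; rewrite /e' mulrCA -[ltRHS]mulr1 ltr_pM2l //.
  by rewrite ltr_pdivrMr ?ltr_pwDr // mul1r ltrDl.
have lim : (fun h : R => h^-1 *: ((g \o shift x) (h *: (u + c *: v)) - g x))
    @ 0^' --> (du + c * 'D_v g x : R^o).
  have -> : (fun h : R => h^-1 *: ((g \o shift x) (h *: (u + c *: v)) - g x)) =
      (fun h : R => h^-1 *: ((g \o shift x) (h *: u) - g x) +
        h^-1 * (g (h *: (u + c *: v) + x) - g (h *: u + x))).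
    apply/funext => h /=.
    by rewrite /GRing.scale /= -mulrDr [in RHS]addrC addrA subrK.
  apply: cvgD => //.
  by rewrite -du2; exact: du1.
split; first by apply/cvg_ex; eexists; exact: lim.
exact: (cvg_lim _ lim).
Qed.

Lemma is_derive_sum_dir (I : Type) (s : seq I) (e : I -> V) (c : I -> R) g A x :
  open A -> A x ->
  (forall i y, A y -> derivable g y (e i)) ->
  (forall i, {for x, continuous ('D_(e i) g)}) ->
  is_derive x (\sum_(i <- s) c i *: e i) g (\sum_(i <- s) c i * 'D_(e i) g x).
Proof.
move=> oA Ax dg cg; elim: s => [|i s IH].
  by rewrite !big_nil; exact: is_derive0.
rewrite !big_cons addrC [X in is_derive _ _ _ X]addrC.
by apply: (is_derive_add_dir (A := A)) => // y Ay; apply: dg.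
Qed.

(** Mean value theorem along [u] for a difference taken along [v], then along [v] for ['D_u g]. *)
Lemma mixed_difference g A x u v (t : R) : 0 < t ->
  (forall r s : R, 0 <= r <= t -> 0 <= s <= t -> A (x + r *: u + s *: v)) ->
  (forall y, A y -> derivable g y u) ->
  (forall y, A y -> derivable ('D_u g) y v) ->
  exists r s : R, [/\ 0 <= r <= t, 0 <= s <= t &
    g (x + t *: u + t *: v) - g (x + t *: u) - (g (x + t *: v) - g x) =
    t * t * 'D_v ('D_u g) (x + r *: u + s *: v)].
Proof.
move=> t0 At du dvu; have tt : 0 <= t <= t by rewrite lexx ltW.
have zt : 0 <= (0 : R) <= t by rewrite lexx ltW.
have swap (r s : R) : x + s *: v + r *: u = x + r *: u + s *: v by rewrite addrAC.
pose F (r : R) := g (x + t *: v + r *: u) - g (x + r *: u).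
pose F' (r : R) := 'D_u g (x + t *: v + r *: u) - 'D_u g (x + r *: u).
have [|r rt Er] := @MVT_le R F F' 0 t (ltW t0).
  move=> r rt.
  have A1 : A (x + t *: v + r *: u) by rewrite swap; apply: At.
  have A2 : A (x + r *: u) by rewrite -[_ + _]addr0 -(scale0r v); apply: At.
  have d1 := is_derive_line (derivableP (du _ A1)).
  have d2 := is_derive_line (derivableP (du _ A2)).
  exact: is_deriveB.
have [|s st Es] := @MVT_le R (fun s : R => 'D_u g (x + r *: u + s *: v))
    (fun s => 'D_v ('D_u g) (x + r *: u + s *: v)) 0 t (ltW t0).
  by move=> s st; exact: is_derive_line (derivableP (dvu _ (At _ _ rt st))).
exists r, s; split=> //.
move: Er; rewrite /F /F' scale0r !addr0 subr0 (swap t t) => ->.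
move: Es; rewrite scale0r !addr0 subr0 (swap r t) => ->.
by rewrite mulrC [X in _ * X]mulrC mulrA.
Qed.

(** The second difference over a small parallelogram is symmetric in [u] and [v]. Evaluated in both
    orders, it makes the two mixed derivatives agree at a pair of points close to [x], and
    continuity brings both back to [x]. *)
Lemma derive_commute g A x u v : open A -> A x ->
  (forall y, A y -> [/\ derivable g y u, derivable g y v,
    derivable ('D_u g) y v & derivable ('D_v g) y u]) ->
  {for x, continuous ('D_v ('D_u g))} -> {for x, continuous ('D_u ('D_v g))} ->
  'D_v ('D_u g) x = 'D_u ('D_v g) x.
Proof.
move=> oA Ax dg cvu cuv; apply/eqP; rewrite -subr_eq0 -normr_le0.
apply/ler_addgt0Pl => e e0; rewrite addr0.
have e2 : 0 < e / 2 by rewrite divr_gt0.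
have : \forall y \near x, A y /\ (`|'D_v ('D_u g) x - 'D_v ('D_u g) y| < e / 2 /\
    `|'D_u ('D_v g) x - 'D_u ('D_v g) y| < e / 2).
  apply: filterI; first exact: open_nbhs_nbhs.
  apply: filterI.
    by move/cvgrPdist_lt : cvu; apply.
  by move/cvgrPdist_lt : cuv; apply.
move=> /nbhs_ballP[rho /= rho0 H].
pose K := `|u| + `|v| + 1.
have K0 : 0 < K by rewrite ltr_pwDr // addr_ge0.
pose t := rho / K / 2.
have t0 : 0 < t by rewrite !divr_gt0.
have inb (r s : R) : 0 <= r <= t -> 0 <= s <= t -> ball x rho (x + r *: u + s *: v).
  move=> /andP[r0 rt] /andP[s0 st]; rewrite -ball_normE /= distrC.
  rewrite addrC !addrA addNr add0r (le_lt_trans (ler_normD _ _)) // !normrZ !ger0_norm //.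
  apply: (@le_lt_trans _ _ (t * `|u| + t * `|v|)); first by rewrite lerD // ler_wpM2r.
  rewrite -mulrDr; have : t * K < rho.
    by rewrite /t mulrAC divfK ?gt_eqF // ltr_pdivrMr // mulr_natr mulr2n ltrDl.
  by apply: le_lt_trans; rewrite ler_wpM2l ?lerDl // ltW.
have swap (r s : R) : x + r *: u + s *: v = x + s *: v + r *: u by rewrite addrAC.
have [|||r [s [rt st E1]]] := @mixed_difference g (ball x rho) x u v t t0.
- exact: inb.
- by move=> y /H [/dg []].
- by move=> y /H [/dg []].
have [|||r' [s' [rt' st' E2]]] := @mixed_difference g (ball x rho) x v u t t0.
- by move=> a b ha hb; rewrite -swap; apply: inb.
- by move=> y /H [/dg []].
- by move=> y /H [/dg []].
have tt : t * t != 0 by rewrite mulf_neq0 // gt_eqF.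
have E12 : g (x + t *: u + t *: v) - g (x + t *: u) - (g (x + t *: v) - g x) =
    g (x + t *: v + t *: u) - g (x + t *: v) - (g (x + t *: u) - g x).
  rewrite [in LHS]swap; move: (g _) (g _) (g _) (g x) => y1 y2 y3 y4.
  by rewrite !opprB [X in _ + X = _]addrC addrACA [X in _ + X = _]addrC.
have E := mulfI tt (etrans (esym E1) (etrans E12 E2)).
have [_ [H1 _]] := H _ (inb _ _ rt st).
have inb' := inb _ _ st' rt'; rewrite swap in inb'.
have [_ [_ H2]] := H _ inb'.
rewrite E in H1; exact: (ler_dist_half H1 H2).
Qed.

End DirectionalDerivatives.

Section IteratedPartials.
Variables (R : realType) (d : nat) (W : normedModType R).
Implicit Types (g h : 'rV[R]_d -> W) (A : set 'rV[R]_d) (I J : seq 'I_d).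

Lemma partial_eq_on A g h i : open A -> (forall x, A x -> g x = h x) ->
  forall x, A x -> partial i g x = partial i h x.
Proof.
move=> oA gh x Ax; apply: near_eq_derive.
by apply: filterS (open_nbhs_nbhs (conj oA Ax)) => y /gh.
Qed.

Lemma continuous_eq_on A g h x : open A -> A x -> (forall y, A y -> g y = h y) ->
  {for x, continuous g} -> {for x, continuous h}.
Proof.
move=> oA Ax gh cg; rewrite /prop_for /continuous_at -(gh _ Ax).
have E : \forall y \near x, g y = h y.
  by apply: filterS (open_nbhs_nbhs (conj oA Ax)) => y /gh.
exact: cvg_trans (near_eq_cvg E) cg.
Qed.

Lemma C_on_eq k A g h : open A -> (forall x, A x -> g x = h x) ->
  C_on k A g -> C_on k A h.
Proof.
move=> oA; elim: k g h => [|k IH] g h gh [cg dg].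
  by split=> // x Ax; apply: continuous_eq_on gh (cg _ Ax).
split=> [x Ax|i]; first exact: continuous_eq_on gh (cg _ Ax).
have [dgi Ci] := dg i; split; last by apply: IH Ci; apply: partial_eq_on.
move=> x Ax; apply: near_eq_derivable (dgi _ Ax).
by apply: filterS (open_nbhs_nbhs (conj oA Ax)) => y /gh.
Qed.

Lemma C_on_le k m A g : (k <= m)%N -> C_on m A g -> C_on k A g.
Proof.
elim: k m g => [|k IH] [|m] g //; first by move=> _ [].
by move=> km [cg dg]; split=> // i; have [? ?] := dg i; split=> //; apply: IH km _.
Qed.

Definition partials I g := foldr (fun i h => partial i h) g I.

Lemma C_on_partials k A g I : C_on (size I + k) A g -> C_on k A (partials I g).
Proof.
elim: I k => [//|i I IH] k; rewrite [size _]/= addSnnS => /IH [_ dg].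
by have [] := dg i.
Qed.

(** Viewing a multi-index as a word of variables reduces the order of differentiation to
    permutations of words. *)
Definition multi_word (beta : 'I_d -> nat) : seq 'I_d :=
  flatten [seq nseq (beta i) i | i <- enum 'I_d].

Lemma mpartialE beta g : mpartial beta g = partials (multi_word beta) g.
Proof.
rewrite /mpartial /multi_word; elim: (enum 'I_d) => //= i s ->.
rewrite /partials foldr_cat; move: (foldr _ g _) => h.
by elim: (beta i) => //= m ->.
Qed.

Lemma size_multi_word beta : size (multi_word beta) = (\sum_i beta i)%N.
Proof.
rewrite /multi_word size_flatten /shape -map_comp sumnE big_map big_enum /=.
by apply: eq_bigr => i _; rewrite size_nseq.
Qed.

Lemma count_multi_word beta j : count_mem j (multi_word beta) = beta j.
Proof.
rewrite /multi_word count_flatten -map_comp sumnE big_map big_enum /=.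
rewrite (bigD1 j) //= count_nseq /= eqxx mul1n big1 ?addn0 // => i ij.
by rewrite count_nseq /= (negbTE ij) mul0n.
Qed.

Definition incr_multi (i : 'I_d) (beta : 'I_d -> nat) : 'I_d -> nat :=
  fun j => (beta j + (j == i))%N.

Lemma sum_incr_multi i beta : (\sum_j incr_multi i beta j = (\sum_j beta j).+1)%N.
Proof.
rewrite big_split /= -addn1; congr addn.
by rewrite (bigD1 i) //= eqxx big1 // => j /negbTE ->.
Qed.

Lemma perm_multi_word_incr i beta :
  perm_eq (i :: multi_word beta) (multi_word (incr_multi i beta)).
Proof.
apply/allP => j _ /=; rewrite !count_multi_word /incr_multi addnC eq_sym.
by rewrite [j == i]eq_sym.
Qed.

End IteratedPartials.

(** * Symmetry of iterated partial derivatives *)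

Section CommutingPartials.
Variables (R : realType) (d : nat).
Implicit Types (g : 'rV[R]_d -> R^o) (A : set 'rV[R]_d) (I J : seq 'I_d).

Lemma partial_commute A g i j : open A -> C_on 2 A g ->
  forall x, A x -> partial i (partial j g) x = partial j (partial i g) x.
Proof.
move=> oA [_ dg] x Ax.
apply: (@derive_commute R 'rV[R]_d g A x (delta_mx 0 j) (delta_mx 0 i)) => //.
- move=> y Ay; have [dj [_ dj']] := dg j; have [di [_ di']] := dg i.
  by split; [exact: dj|exact: di|exact: (dj' i).1|exact: (di' j).1].
- by have [_ [_ /(_ i) [_ [cj _]]]] := dg j; apply: cj.
- by have [_ [_ /(_ j) [_ [ci _]]]] := dg i; apply: ci.
Qed.

Lemma partials_rem A g i I : open A -> i \in I -> C_on (size I) A g ->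
  forall x, A x -> partials I g x = partials (i :: rem i I) g x.
Proof.
move=> oA; elim: I => [//|j I IH] iI Cg x Ax /=.
case: eqVneq => [->//|ji].
have iI' : i \in I by move: iI; rewrite inE eq_sym (negbTE ji).
have CI : C_on (size I) A g by apply: C_on_le Cg => /=.
have := partial_eq_on j oA (IH iI' CI) Ax => /= ->.
apply: partial_commute Ax => //; apply: C_on_partials.
by apply: C_on_le Cg => /=; rewrite size_rem // addn2 prednK //; case: (I) iI'.
Qed.

Lemma partials_perm A g I J : open A -> perm_eq I J -> C_on (size I) A g ->
  forall x, A x -> partials I g x = partials J g x.
Proof.
move=> oA; elim: I J => [|i I IH] J IJ Cg x Ax.
  by move: IJ; rewrite perm_sym => /perm_nilP ->.
have iJ : i \in J by rewrite -(perm_mem IJ) mem_head.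
rewrite (partials_rem oA iJ _ Ax) -?(perm_size IJ) //.
apply: (partial_eq_on i oA _ Ax) => y Ay; apply: IH => //.
  by have := perm_to_rem iJ; rewrite -(permPl IJ) perm_cons.
exact: C_on_le Cg.
Qed.

(** [mpartial] fixes the order of the variables, so differentiating once more along [i] gives a
    different word for the incremented multi-index; the two words are permutations of each other. *)
Lemma partial_mpartial A g i beta l : open A -> C_on l A g ->
  (\sum_j beta j < l)%N -> forall x, A x ->
  partial i (mpartial beta g) x = mpartial (incr_multi i beta) g x.
Proof.
move=> oA Cg bl x Ax; rewrite !mpartialE.
rewrite -(partials_perm oA (perm_multi_word_incr i beta) _ Ax) //.
by apply: C_on_le Cg; rewrite /= size_multi_word.
Qed.

End CommutingPartials.

Section Jets.
Variables (R : realType) (d : nat).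
Implicit Types (T : ('I_d -> nat) -> R) (v w : 'rV[R]_d) (beta : 'I_d -> nat).

(** The derivation [sum_i v_i d_i] acting formally on the family of all partial derivatives at a
    point. On such families these operators always commute, so polarisation becomes algebra, free of
    smoothness conditions. *)
Definition jet_dir v T : ('I_d -> nat) -> R :=
  fun beta => \sum_i v 0 i * T (incr_multi i beta).

Definition jet (g : 'rV[R]_d -> R^o) (x : 'rV[R]_d) : ('I_d -> nat) -> R :=
  fun beta => mpartial beta g x.

(** Links the formal operators with analysis: their iterates on the jet are the successive
    derivatives along a line, which is the sequence [u] of the one-dimensional estimate. *)
Lemma is_derive_jet_dir A (g : 'rV[R]_d -> R^o) (l m : nat) x v (s : R) beta :
  open A -> C_on l A g -> A (x + s *: v) -> (m + \sum_i beta i < l)%N ->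
  is_derive s 1 (fun t => iter m (jet_dir v) (jet g (x + t *: v)) beta)
    (iter m.+1 (jet_dir v) (jet g (x + s *: v)) beta).
Proof.
move=> oA Cg As; elim: m beta => [|m IH] beta ml.
  have C1 : C_on 1 A (mpartial beta g).
    rewrite mpartialE; apply: C_on_partials; apply: C_on_le Cg.
    by rewrite size_multi_word addn1.
  have [_ dg] := C1.
  apply: is_derive_line.
  have vE : v = \sum_(i <- enum 'I_d) v 0 i *: delta_mx 0 i.
    by rewrite big_enum; exact: row_sum_delta.
  rewrite [X in is_derive _ X]vE.
  have -> : iter 1 (jet_dir v) (jet g (x + s *: v)) beta =
      \sum_(i <- enum 'I_d) v 0 i * 'D_(delta_mx 0 i) (mpartial beta g) (x + s *: v).
    rewrite /= /jet_dir /jet big_enum /=; apply: eq_bigr => i _; congr (_ * _).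
    by rewrite -(partial_mpartial i oA Cg ml As).
  apply: (is_derive_sum_dir _ _ oA As) => [i y Ay|i].
    by apply: (dg i).1.
  by apply: (dg i).2.1.
have -> : (fun t : R => iter m.+1 (jet_dir v) (jet g (x + t *: v)) beta) =
    \sum_i (fun t : R => v 0 i *
      iter m (jet_dir v) (jet g (x + t *: v)) (incr_multi i beta)).
  by apply/funext => t; rewrite fct_sumE.
rewrite iterS {1}/jet_dir; apply: is_derive_sum => i.
apply: is_deriveZ; apply: IH.
by rewrite sum_incr_multi addnS.
Qed.

End Jets.

Section LinearForms.
Variables (R : realType) (d n : nat).
Implicit Types (f : 'rV[R]_d -> 'rV[R]_n) (a : 'rV[R]_n) (A : set 'rV[R]_d).

Lemma lin_formE f a x : lin_form f a x = \sum_j f x 0 j * a 0 j.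
Proof. by rewrite /lin_form mxE; apply: eq_bigr => j _; rewrite mxE. Qed.

Lemma is_derive_lin_form f a x v : derivable f x v ->
  is_derive x v (lin_form f a : _ -> R^o) (lin_form ('D_v f) a x).
Proof.
move=> df; have -> : lin_form f a = \sum_j (fun y => a 0 j * f y 0 j : R^o).
  by apply/funext => y; rewrite fct_sumE lin_formE; apply: eq_bigr => j _; rewrite mulrC.
have -> : lin_form ('D_v f) a x = \sum_j a 0 j * 'D_v (fun y => f y 0 j : R^o) x.
  by rewrite lin_formE (derive_mx df); apply: eq_bigr => j _; rewrite mxE mulrC.
apply: is_derive_sum => j; apply: is_deriveZ; apply: derivableP.
by move/derivable_mxP : df; apply.
Qed.

Lemma continuous_lin_form f a x : {for x, continuous f} ->
  {for x, continuous (lin_form f a : _ -> R^o)}.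
Proof.
move=> cf; have -> : lin_form f a = (fun y => \sum_j f y 0 j * a 0 j : R^o).
  by apply/funext => y; rewrite lin_formE.
apply: (@cvg_big R^o _ +%R 0 predT add_continuous _ (nbhs x)) => j _.
apply: (@cvgMr_tmp R _ (nbhs x)).
exact: (continuous_comp cf (@coord_continuous _ _ _ 0 j (f x))).
Qed.

Lemma C_on_lin_form k A f a : open A -> C_on k A f ->
  C_on k A (lin_form f a : _ -> R^o).
Proof.
move=> oA; elim: k f => [|k IH] f [cf df]; split.
1,3: by move=> x Ax; apply: continuous_lin_form; apply: cf.
- by [].
- move=> i; have [dfi Ci] := df i; split.
    by move=> x Ax; have [] := is_derive_lin_form a (dfi _ Ax).
  apply: C_on_eq (IH _ Ci) => // x Ax.
  by have [_ <-] := is_derive_lin_form a (dfi _ Ax).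
Qed.

Lemma partials_lin_form A f a I : open A -> C_on (size I) A f ->
  forall x, A x ->
  partials I (lin_form f a : _ -> R^o) x = lin_form (partials I f) a x.
Proof.
move=> oA; elim: I => [//|i I IH] Cf x Ax /=.
have CI : C_on (size I) A f by apply: C_on_le Cf => /=.
rewrite (partial_eq_on i oA (IH CI) Ax).
have [_ /(_ i) [di _]] : C_on 1 A (partials I f).
  by apply: C_on_partials; rewrite addn1.
by have [_ <-] := is_derive_lin_form a (di _ Ax).
Qed.

Lemma mpartial_lin_form A f a l beta : open A -> C_on l A f ->
  (\sum_i beta i <= l)%N -> forall x, A x ->
  mpartial beta (lin_form f a : _ -> R^o) x = lin_form (mpartial beta f) a x.
Proof.
move=> oA Cf bl x Ax; rewrite !mpartialE; apply: partials_lin_form Ax => //.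
by apply: C_on_le Cf; rewrite size_multi_word.
Qed.

End LinearForms.

(** * Directions along which a high derivative is large *)

Section JetAlgebra.
Variables (R : realType) (d : nat).
Implicit Types (T : ('I_d -> nat) -> R) (v w : 'rV[R]_d) (beta : 'I_d -> nat).

Lemma jet_dirD v w (s : R) T beta :
  jet_dir (v + s *: w) T beta = jet_dir v T beta + s * jet_dir w T beta.
Proof.
rewrite /jet_dir mulr_sumr -big_split /=; apply: eq_bigr => i _.
by rewrite !mxE mulrDl mulrA.
Qed.

Lemma incr_multiC i j beta :
  incr_multi i (incr_multi j beta) = incr_multi j (incr_multi i beta).
Proof. by apply/funext => k; rewrite /incr_multi addnAC. Qed.

Lemma jet_dirC v w T : jet_dir v (jet_dir w T) = jet_dir w (jet_dir v T).
Proof.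
apply/funext => beta; rewrite /jet_dir.
under eq_bigr do rewrite mulr_sumr.
rewrite exchange_big /=; apply: eq_bigr => i _.
rewrite mulr_sumr; apply: eq_bigr => j _.
by rewrite incr_multiC mulrCA.
Qed.

Lemma iter_jet_dirC m v w T :
  iter m (jet_dir v) (jet_dir w T) = jet_dir w (iter m (jet_dir v) T).
Proof. by elim: m => //= m ->; rewrite jet_dirC. Qed.

Lemma jet_dir_delta i T beta : jet_dir (delta_mx 0 i) T beta = T (incr_multi i beta).
Proof.
rewrite /jet_dir (bigD1 i) //= mxE !eqxx mul1r big1 ?addr0 // => j ji.
by rewrite mxE (negbTE ji) mul0r.
Qed.

Lemma jet_dir_sum v (n : nat) (c : nat -> R) (F : nat -> ('I_d -> nat) -> R) beta :
  jet_dir v (fun gamma => \sum_(j < n) c j * F j gamma) beta =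
  \sum_(j < n) c j * jet_dir v (F j) beta.
Proof.
rewrite /jet_dir; under eq_bigr do rewrite mulr_sumr.
rewrite exchange_big /=; apply: eq_bigr => j _.
by rewrite mulr_sumr; apply: eq_bigr => i _; rewrite mulrCA.
Qed.

(** Binomial formula for the commuting operators [jet_dir v] and [s * jet_dir w]; as a polynomial in
    [s], its coefficients are the mixed derivatives. *)
Lemma iter_jet_dirD m v w (s : R) T beta :
  iter m (jet_dir (v + s *: w)) T beta =
  \sum_(j < m.+1) ('C(m, j)%:R * s ^+ j) *
    iter (m - j) (jet_dir v) (iter j (jet_dir w) T) beta.
Proof.
elim: m beta => [|m IH] beta.
  by rewrite big_ord1 bin0 !mul1r.
pose c i j := iter i (jet_dir v) (iter j (jet_dir w) T).
have {}IH : iter m (jet_dir (v + s *: w)) T =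
    fun gamma => \sum_(j < m.+1) ('C(m, j)%:R * s ^+ j) * c (m - j)%N j gamma.
  by apply/funext => gamma; rewrite IH.
rewrite iterS IH jet_dirD.
rewrite (jet_dir_sum v m.+1 (fun j => 'C(m, j)%:R * s ^+ j) (fun j => c (m - j)%N j)).
rewrite (jet_dir_sum w m.+1 (fun j => 'C(m, j)%:R * s ^+ j) (fun j => c (m - j)%N j)).
have -> : \sum_(j < m.+1) 'C(m, j)%:R * s ^+ j * jet_dir v (c (m - j)%N j) beta =
    \sum_(j < m.+2) 'C(m, j)%:R * s ^+ j * c (m.+1 - j)%N j beta.
  rewrite [RHS]big_ord_recr /= bin_small // !mul0r addr0; apply: eq_bigr => j _.
  by rewrite subSn // -ltnS.
rewrite [in LHS]big_ord_recl [in RHS]big_ord_recl /= !bin0 -addrA; congr (_ + _).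
rewrite mulr_sumr -big_split /=; apply: eq_bigr => j _.
rewrite /bump /= add1n subSS binS natrD !mulrDl; congr (_ + _).
by rewrite /c /= iter_jet_dirC exprS mulrA; congr (_ * _); rewrite mulrCA.
Qed.

Lemma iter_jet_dirZ m (r : R) v T beta :
  iter m (jet_dir (r *: v)) T beta = r ^+ m * iter m (jet_dir v) T beta.
Proof.
elim: m beta => [|m IH] beta; first by rewrite mul1r.
rewrite /= /jet_dir mulr_sumr; apply: eq_bigr => i _.
by rewrite IH mxE exprS -!mulrA; congr (_ * _); rewrite mulrCA.
Qed.

Lemma iter_jet_dir_dist m v T T' beta (e : R) :
  (forall gamma, (\sum_i gamma i = m + \sum_i beta i)%N ->
    `|T gamma - T' gamma| <= e) ->
  `|iter m (jet_dir v) T beta - iter m (jet_dir v) T' beta| <=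
    (\sum_i `|v 0 i|) ^+ m * e.
Proof.
elim: m beta => [|m IH] beta TT'; first by rewrite mul1r; apply: TT'.
rewrite /= /jet_dir -sumrB exprS -mulrA mulr_suml.
apply: le_trans (ler_norm_sum _ _ _) _; apply: ler_sum => i _.
rewrite -mulrBr normrM ler_wpM2l // IH // => gamma.
by rewrite sum_incr_multi addnS => /TT'.
Qed.

(** Interpolation: the Vandermonde matrix of the distinct nodes 1, ..., k is invertible. The nodes
    start at 1 so that the shifts of directions obtained from them are nonzero. *)
Lemma coef_le_values (k : nat) : exists2 K : R, 0 < K &
  forall (q : nat -> R) (M : R),
  (forall i, (i < k)%N -> `|\sum_(j < k) q j * i.+1%:R ^+ j| <= M) ->
  forall j, (j < k)%N -> `|q j| <= K * M.
Proof.
pose a : 'rV[R]_k := \row_i i.+1%:R.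
pose V := Vandermonde k a.
have Vu : V \in unitmx.
  rewrite unitmxE det_Vandermonde unitfE; apply/prodf_neq0 => i _.
  apply/prodf_neq0 => j ij; rewrite !mxE subr_eq0 eqr_nat eqSS.
  by rewrite gtn_eqF.
exists (1 + \sum_i \sum_j `|invmx V i j|).
  by rewrite ltr_pwDl // sumr_ge0 // => i _; rewrite sumr_ge0.
move=> q M qM j jk; pose Q : 'rV[R]_k := \row_i q i.
have k0 : (0 < k)%N by apply: leq_ltn_trans jk.
have M0 : 0 <= M by apply: le_trans (qM _ k0).
have -> : q j = (Q *m V *m invmx V) 0 (Ordinal jk) by rewrite mulmxK // mxE.
rewrite mxE mulrDl mul1r ler_wpDl // mulr_suml.
apply: le_trans (ler_norm_sum _ _ _) _; apply: ler_sum => i _.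
rewrite normrM mulrC; apply: ler_pM => //.
  by rewrite (bigD1 (Ordinal jk)) //= lerDl sumr_ge0.
rewrite mxE; under eq_bigr do rewrite !mxE; exact: qM.
Qed.

(** A polynomial with one large coefficient is large at one of the nodes. Using [l.+1] nodes for
    every [m <= l] makes [c] depend on [l] alone. *)
Lemma iter_jet_dir_shear (l : nat) : exists2 c : R, 0 < c <= 1 &
  forall m j v w T beta (kappa : R), (m <= l)%N -> (j <= m)%N -> 0 < kappa ->
  kappa <= `|iter (m - j) (jet_dir v) (iter j (jet_dir w) T) beta| ->
  exists2 i : nat, (i <= l)%N &
    c * kappa <= `|iter m (jet_dir (v + i.+1%:R *: w)) T beta|.
Proof.
have [K K0 HK] := coef_le_values l.+1.
have K1 : 0 < K + 1 by rewrite ltr_wpDl // ltW.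
(* [K + 1] instead of [K] gives [c <= 1] and makes the final comparison strict. *)
exists (K + 1)^-1; first by rewrite invr_gt0 K1 /= invf_le1 // lerDr ltW.
move=> m j v w T beta kappa ml jm k0 hk.
apply: contrapT => Hn.
pose q i := 'C(m, i)%:R * iter (m - i) (jet_dir v) (iter i (jet_dir w) T) beta.
have qE (s : R) : iter m (jet_dir (v + s *: w)) T beta = \sum_(i < l.+1) q i * s ^+ i.
  rewrite iter_jet_dirD (big_ord_widen l.+1
    (fun i => 'C(m, i)%:R * s ^+ i *
      iter (m - i) (jet_dir v) (iter i (jet_dir w) T) beta)) //.
  rewrite big_mkcond /=; apply: eq_bigr => i _; rewrite /q mulrAC.
  by case: ltnP => // mi; rewrite bin_small // !mul0r.
have jl : (j < l.+1)%N by rewrite ltnS (leq_trans jm).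
have := HK q ((K + 1)^-1 * kappa) _ j jl.
have H i : (i < l.+1)%N -> `|\sum_(j < l.+1) q j * i.+1%:R ^+ j| <= (K + 1)^-1 * kappa.
  move=> il; rewrite leNgt; apply/negP => lt; apply: Hn; exists i => //.
  by rewrite qE ltW.
move=> /(_ H); apply/negP; rewrite -ltNge mulrA.
apply: (@lt_le_trans _ _ kappa).
  by rewrite gtr_pMl // ltr_pdivrMr // mul1r ltrDl.
apply: le_trans hk _; rewrite /q normrM ler_peMl // normr_nat ler1n bin_gt0 //.
Qed.

Lemma normr_delta_mx (i : 'I_d) : `|delta_mx 0 i : 'rV[R]_d| <= 1.
Proof.
rewrite /Num.norm /= mx_normrE; apply: bigmax_le => // -[a b] _.
by rewrite mxE; case: (_ && _); rewrite ?normr1 ?normr0.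
Qed.

Lemma multi0P beta : (\sum_i beta i = 0)%N -> beta = fun=> 0%N.
Proof.
by move=> /eqP; rewrite sum_nat_eq0 => /forallP b0; apply/funext => i; apply/eqP/b0.
Qed.

Lemma multi_pos beta p : (\sum_i beta i = p.+1)%N ->
  exists i gamma, beta = incr_multi i gamma /\ (\sum_i gamma i = p)%N.
Proof.
move=> bp; have [i bi] : exists i, (0 < beta i)%N.
  apply: contrapT => H; move: bp; rewrite big1 // => i _.
  by apply/eqP; rewrite eqn0Ngt; apply/negP => bi; apply: H; exists i.
pose gamma j := (beta j - (j == i))%N.
have E : beta = incr_multi i gamma.
  apply/funext => j; rewrite /incr_multi /gamma subnK //.
  by case: eqP => // ->.
exists i, gamma; split=> //.
by apply: succn_inj; rewrite -bp E sum_incr_multi.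
Qed.

Lemma jet_directions (l : nat) : exists2 c : R, 0 < c &
  forall T beta (kappa : R), (1 <= \sum_i beta i <= l)%N -> 0 < kappa ->
  kappa <= `|T beta| ->
  exists k (w0 : 'rV[R]_d) (s : 'I_d -> nat),
  [/\ (1 <= k <= l)%N, forall i, (0 < s i)%N,
    `|w0| <= (l.+1 ^ 2)%:R /\
      c * kappa <= `|iter k (jet_dir w0) T (fun=> 0%N)| &
    forall i, `|w0 + (s i)%:R *: delta_mx 0 i| <= (l.+1 ^ 2)%:R /\
      c * kappa <= `|iter k (jet_dir (w0 + (s i)%:R *: delta_mx 0 i)) T (fun=> 0%N)|].
Proof.
have [c /andP[c0 c1] shear] := iter_jet_dir_shear l.
(* Each step removes one index [i] from [beta] and absorbs it into the direction: a derivative [d_i]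
   of an m-th derivative along [v] is traded for an (m+1)-st derivative along [v + j e_i], with
   [1 <= j <= l + 1], at the price of a factor [c]. *)
have build p : forall m v T beta (kappa : R), (\sum_i beta i = p)%N ->
    (m + p <= l)%N -> 0 < kappa -> kappa <= `|iter m (jet_dir v) T beta| ->
    exists2 w : 'rV[R]_d, `|w| <= `|v| + (p * l.+1)%:R &
      c ^+ p * kappa <= `|iter (m + p) (jet_dir w) T (fun=> 0%N)|.
  elim: p => [|p IH] m v T beta kappa bp mp k0 hk.
    exists v; first by rewrite mul0n addr0.
    by rewrite addn0 mul1r -(multi0P bp).
  have [i [gamma [bE gp]]] := multi_pos bp.
  have ml : (m.+1 <= l)%N by apply: leq_trans mp; rewrite addnS ltnS leq_addr.
  have [|j jl hj] := shear m.+1 1%N v (delta_mx 0 i) T gamma kappa ml isT k0.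
    by rewrite subn1 /= iter_jet_dirC jet_dir_delta -bE.
  have [|w wv hw] := IH m.+1 _ T gamma _ gp _ (mulr_gt0 c0 k0) hj.
    by rewrite addSnnS.
  exists w; last by rewrite addnS exprSr -mulrA -addSn.
  apply: le_trans wv _; rewrite mulSn natrD addrA lerD2r.
  apply: le_trans (ler_normD _ _) _; rewrite lerD2l normrZ normr_nat.
  by apply: le_trans (ler_wpM2l _ (normr_delta_mx i)) _; rewrite // mulr1 ler_nat.
exists (c ^+ l.+1); first by rewrite exprn_gt0.
move=> T beta kappa /andP[b1 bl] k0 hk; set k := (\sum_i beta i)%N in b1 bl.
have [||w0 w0N hw0] := build k 0%N 0 T beta kappa erefl _ k0; rewrite ?add0n //.
have ck0 : 0 < c ^+ k * kappa by rewrite mulr_gt0 ?exprn_gt0.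
(* Here the large coefficient is the constant one, the k-th derivative along [w0] itself. This is
   the last of at most [l + 1] shears, hence the factor [c ^+ l.+1]. *)
have sh i : exists si : nat, [/\ (0 < si)%N, (si <= l.+1)%N &
    c * (c ^+ k * kappa) <=
    `|iter k (jet_dir (w0 + si%:R *: delta_mx 0 i)) T (fun=> 0%N)|].
  have [|j jl hj] := shear k 0%N w0 (delta_mx 0 i) T (fun=> 0%N) _ bl isT ck0.
    by rewrite subn0.
  by exists j.+1.
pose s i := sval (cid (sh i)).
have sP i := svalP (cid (sh i)).
have cl m : (m <= l.+1)%N -> c ^+ l.+1 * kappa <= c ^+ m * kappa.
  by move=> ml; rewrite ler_wpM2r ?(ltW k0) // ler_wiXn2l // ltW.
rewrite normr0 add0r in w0N.
have kl : (k * l.+1 + l.+1 <= l.+1 ^ 2)%N by rewrite -mulSnr -mulnn leq_mul.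
exists k, w0, s; split; first by rewrite b1.
- by move=> i; have [] := sP i.
- split; last by apply: le_trans (cl k _) hw0; rewrite leqW.
  apply: le_trans w0N _; rewrite ler_nat; apply: leq_trans kl.
  exact: leq_addr.
- move=> i; have [_ sl hs] := sP i; split.
    apply: le_trans (ler_normD _ _) _; rewrite normrZ normr_nat.
    apply: (@le_trans _ _ ((k * l.+1)%:R + l.+1%:R)); last by rewrite -natrD ler_nat.
    apply: lerD => //; apply: le_trans (ler_wpM2l _ (normr_delta_mx i)) _ => //.
    by rewrite mulr1 ler_nat.
  by apply: le_trans hs; rewrite mulrA -exprS; apply: cl; rewrite ltnS.
Qed.

End JetAlgebra.

(** * Averaging over segments *)

Lemma covered_lebesgue (R : realType) (S : set R) (X : R) :
  measurable (S : set (measurableTypeR R)) -> covered S X ->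
  (lebesgue_measure S <= X%:E)%E.
Proof.
move=> mS [s [Ss s0 sX]].
pose U (t : seq (R * R)) : set (measurableTypeR R) :=
  \big[setU/set0]_(b <- t) `[b.1 - b.2, b.1 + b.2]%classic.
have mU t : measurable (U t) by apply: bigsetU_measurable => b _; exact: measurable_itv.
have SU : S `<=` U s.
  move=> x /Ss [b bs xb]; rewrite /U -bigcup_seq; exists b => //=.
  by rewrite in_itv /=; move: xb; rewrite ler_distl.
apply: (@le_trans _ _ (lebesgue_measure (U s))); first by apply: le_measure; rewrite ?inE.
apply: (@le_trans _ _ (\sum_(b <- s) 2 * b.2)%:E); last by rewrite lee_fin.
elim: s s0 {Ss sX SU} => [|b s IH] s0; first by rewrite /U !big_nil measure0.
have IH' := IH (fun b' hb => s0 b' (mem_behead (s := b :: s) hb)).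
rewrite /U !big_cons EFinD.
apply: (@le_trans _ _ (lebesgue_measure
    (`[(b.1 - b.2)%R, (b.1 + b.2)%R]%classic : set (measurableTypeR R)) +
    lebesgue_measure (U s))%E).
  by apply: measureU2; [exact: measurable_itv|exact: mU].
apply: leeD IH'.
have b0 : 0 <= b.2 by apply: s0; rewrite mem_head.
rewrite lebesgue_measure_itv /= lte_fin; case: ifP => _; rewrite -?EFinD lee_fin; lra.
Qed.

Section PullbackMeasurable.
Variables (R : realType) (d : nat).
Implicit Types S : set 'rV[R]_d.

(* Borel sets, described without equipping ['rV[R]_d] with a sigma-algebra. *)
Definition pullback_measurable S : Prop :=
  forall disp (T : measurableType disp) (psi : T -> 'rV[R]_d),
  (forall i, measurable_fun setT (fun t => psi t 0 i : measurableTypeR R)) ->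
  measurable (psi @^-1` S).

Lemma pullback_measurableI S S' : pullback_measurable S -> pullback_measurable S' ->
  pullback_measurable (S `&` S').
Proof.
by move=> mS mS' disp T psi mpsi; apply: measurableI; [apply: mS|apply: mS'].
Qed.

Lemma pullback_measurableC S : pullback_measurable S -> pullback_measurable (~` S).
Proof. by move=> mS disp T psi mpsi; apply: measurableC; apply: mS. Qed.

Lemma pullback_measurable_bigcup (I : finType) (F : I -> set 'rV[R]_d) :
  (forall i, pullback_measurable (F i)) -> pullback_measurable (\bigcup_i F i).
Proof.
move=> mF disp T psi mpsi; rewrite preimage_bigcup.
by apply: fin_bigcup_measurable => // i _; apply: mF.
Qed.

Lemma pullback_measurable_ball (c : 'rV[R]_d) (e : R) : pullback_measurable (ball c e).
Proof.
move=> disp T psi mpsi; case: (ltP 0 e) => e0; last first.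
  rewrite (_ : _ @^-1` _ = set0); first exact: measurable0.
  by apply/seteqP; split=> // t [] /lt_le_trans/(_ e0); rewrite ltxx.
rewrite (_ : _ @^-1` _ =
    \bigcap_(i : 'I_d) ((fun t => psi t 0 i) @^-1` (ball (c 0 i) e))).
  apply: fin_bigcap_measurable => // i _; rewrite -[X in measurable X]setTI.
  by apply: mpsi => //; exact: measurable_ball.
apply/seteqP; split=> t /=.
  by move=> [_ H] i _; apply: H.
by move=> H; split=> // i j; rewrite (ord1 i); apply: H.
Qed.

(** An open set is the union of the balls inside it with rational centre and radius [k.+1%:R^-1];
    these are countably many, enumerated by [unpickle]. *)
Lemma open_pullback_measurable S : open S -> pullback_measurable S.
Proof.
move=> oS disp T psi mpsi.
pose q2r (q : 'rV[rat]_d) : 'rV[R]_d := map_mx ratr q.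
pose B (n : nat) : set 'rV[R]_d :=
  if @unpickle ('rV[rat]_d * nat)%type n is Some (q, k) then
    if `[< ball (q2r q) k.+1%:R^-1 `<=` S >] then ball (q2r q) k.+1%:R^-1 else set0
  else set0.
have SB : S = \bigcup_n B n.
  apply/seteqP; split=> [x Sx|x [n _]]; last first.
    rewrite /B; case: unpickle => [[q k]|//]; case: asboolP => // sub; exact: sub.
  have /nbhs_ballP[e /= e0 eS] := open_nbhs_nbhs (conj oS Sx).
  (* Twice the radius is below [e], so a ball of this radius that contains [x] stays in the [e]-ball
     around [x]. *)
  pose k := Num.truncn (2 / e).
  have k0 : 0 < k.+1%:R^-1 :> R by rewrite invr_gt0 ltr0n.
  have ke : k.+1%:R^-1 + k.+1%:R^-1 < e :> R.
    have : 2 / e < k.+1%:R by apply: truncnS_gt.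
    rewrite ltr_pdivrMr // => h.
    by rewrite -mulr2n -[_ *+ 2]mulr_natl ltr_pdivrMr ?ltr0n // mulrC.
  have qP i : exists q : rat, `|ratr q - x 0 i| < k.+1%:R^-1.
    have [|q qin] := @rat_in_itvoo R (x 0 i) (x 0 i + k.+1%:R^-1); first by rewrite ltrDl.
    exists q; move: qin; rewrite in_itv /= ltr_distl => /andP[q1 ->].
    by rewrite andbT (lt_trans _ q1) // ltrBlDr ltrDl.
  pose q : 'rV[rat]_d := \row_i sval (cid (qP i)).
  have qx : ball (q2r q) k.+1%:R^-1 x.
    split=> // i j; rewrite (ord1 i) /ball /= !mxE.
    exact: svalP (cid (qP j)).
  have sub : ball (q2r q) k.+1%:R^-1 `<=` S.
    move=> y qy; apply: eS; apply: (le_ball (ltW ke)).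
    by apply: ball_triangle qy; apply: ball_sym.
  exists (pickle (q, k)) => //; rewrite /B pickleK.
  by case: asboolP.
rewrite SB preimage_bigcup; apply: bigcup_measurable => n _.
rewrite /B; case: unpickle => [[q k]|]; last by rewrite preimage_set0.
case: asboolP => _; last by rewrite preimage_set0.
exact: pullback_measurable_ball.
Qed.

End PullbackMeasurable.

(** * Translation invariance and product measures *)

Lemma lebesgue_measure_shift (R : realType) (c : R) (A : set (measurableTypeR R)) :
  measurable A -> lebesgue_measure ((fun t => t + c) @^-1` A) = lebesgue_measure A.
Proof.
move=> mA.
have ms : measurable_fun [set: measurableTypeR R]
    (fun t : measurableTypeR R => t + c : measurableTypeR R).
  exact: measurable_funD.
symmetry; apply: (@lebesgue_measure_unique R
  (pushforward lebesgue_measure (fun t : measurableTypeR R => t + c : measurableTypeR R)))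
  => // _ [[a b]] _ <-.
transitivity (lebesgue_measure (`]a - c, b - c]%classic : set (measurableTypeR R))).
  rewrite /= !lebesgue_measure_itv /= !lte_fin ltrD2r; case: ifP => // _.
  by rewrite -!EFinD; congr EFin; lra.
congr (lebesgue_measure _).
by apply/seteqP; split=> t /=; rewrite !in_itv /=; lra.
Qed.

Section SigmaFiniteProduct.
Context d1 d2 (T1 : measurableType d1) (T2 : measurableType d2) (R : realType).
Variable m1 : {sigma_finite_measure set T1 -> \bar R}.
Variable m2 : {sigma_finite_measure set T2 -> \bar R}.

Lemma sigma_finite_product_measure1 : sigma_finite setT (m1 \x m2)%E.
Proof.
have /sigma_finiteP[F [FT ndF Foo]] := sigma_finiteT m1.
have /sigma_finiteP[G [GT ndG Goo]] := sigma_finiteT m2.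
exists (fun k => F k `*` G k) => [|k].
  apply/esym/seteqP; split=> // -[x y] _.
  have [i _ Fx] : (\bigcup_i F i) x by rewrite -FT.
  have [j _ Gy] : (\bigcup_j G j) y by rewrite -GT.
  exists (maxn i j) => //; split.
    by move/subsetPset : (ndF _ _ (leq_maxl i j)); apply.
  by move/subsetPset : (ndG _ _ (leq_maxr i j)); apply.
have [mF Fk] := Foo k; have [mG Gk] := Goo k; split; first exact: measurableX.
by rewrite product_measure1E // lte_mul_pinfty // ge0_fin_numE.
Qed.

(* Canonical inference on [\x] finds the instance for subprobabilities instead. *)
Definition product_sigma_finite :
    {sigma_finite_measure set (T1 * T2)%type -> \bar R} :=
  HB.pack (@product_measure1 _ _ T1 T2 R m1 m2)
    (Measure_isSigmaFinite.Build _ _ _ (@product_measure1 _ _ T1 T2 R m1 m2)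
      sigma_finite_product_measure1).

End SigmaFiniteProduct.

(* [lebesgue_rV] is realised, on all sets, as a measure pulled back along [phi];
   translations lift to measure-preserving maps [tau]. *)
Lemma lebesgue_rV_model (R : realType) (d : nat) :
  exists (disp : measure_display) (T : measurableType disp)
    (mu : {sigma_finite_measure set T -> \bar R}) (phi : T -> 'rV[R]_d)
    (tau : 'rV[R]_d -> T -> T),
  [/\ forall A, lebesgue_rV A = mu (phi @^-1` A),
      forall i, measurable_fun setT (fun t => phi t 0 i : measurableTypeR R),
      forall v t, phi (tau v t) = phi t + v,
      forall v, measurable_fun setT (tau v) &
      forall v X, measurable X -> mu (tau v @^-1` X) = mu X].
Proof.
elim: d => [|d [disp [T [mu [phi [tau [muE mphi phitau mtau mutau]]]]]]].
  exists _, unit, (@dirac _ unit tt R), (fun _ => 0), (fun _ => id); split => // v _.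
  by apply/rowP; case.
pose T' : measurableType _ := (measurableTypeR R * T)%type.
pose leb : {sigma_finite_measure set (measurableTypeR R) -> \bar R} := lebesgue_measure.
pose phi' (p : T') : 'rV[R]_(1 + d) := row_mx (p.1%:M : 'rV[R]_1) (phi p.2).
pose tau' (v : 'rV[R]_(1 + d)) (p : T') : T' := (p.1 + v 0 0, tau (rsubmx v) p.2).
have lift0E : (0 : 'I_(1 + d)) = lshift d (0 : 'I_1) by apply: val_inj.
have phi'0 p j : phi' p 0 (lshift d j) = p.1.
  by rewrite /phi' row_mxEl mxE (ord1 j) eqxx mulr1n.
have phi'S p j : phi' p 0 (rshift 1 j) = phi p.2 0 j by rewrite /phi' row_mxEr.
have phi'D v p (i : 'I_(1 + d)) : phi' (tau' v p) 0 i = phi' p 0 i + v 0 i.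
  case: (split_ordP i) => j ->; first by rewrite (ord1 j) !phi'0 -lift0E.
  by rewrite !phi'S phitau !mxE.
have mtau' v : measurable_fun setT (tau' v).
  apply: measurable_fun_pair; last exact: measurableT_comp.
  exact: measurable_funD.
exists _, T', (product_sigma_finite leb mu), phi', tau'.
split.
- move=> A; rewrite /= /product_measure1; apply: eq_integral => t _ /=.
  by rewrite muE; congr (mu _); apply/seteqP; split=> y; rewrite /xsection /= ?inE.
- move=> i; case: (@split_ordP 1 d i) => j ->.
    have -> : (fun p => phi' p 0 (lshift d j)) = fst by apply/funext => p; rewrite phi'0.
    exact: measurable_fst.
  have -> : (fun p => phi' p 0 (rshift 1 j)) = (fun t => phi t 0 j) \o snd.
    by apply/funext => p; rewrite phi'S.
  exact: measurableT_comp.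
- by move=> v p; apply/rowP => i; rewrite [RHS]mxE; exact: phi'D.
- exact: mtau'.
- suff : forall (v : 'rV[R]_(1 + d)) X, measurable X ->
      product_sigma_finite leb mu (tau' v @^-1` X) = product_sigma_finite leb mu X by [].
  move=> v X mX; symmetry.
  (* The translated measure agrees with the product measure on rectangles, which determine it. *)
  apply: (@product_measure_unique _ _ _ _ R leb mu (pushforward (leb \x mu)%E (tau' v))) => //.
  move=> A B mA mB; rewrite /= /pushforward.
  pose A' : set (measurableTypeR R) := (fun t : measurableTypeR R => t + v 0 0) @^-1` A.
  pose B' : set T := tau (rsubmx v) @^-1` B.
  have mA' : measurable A' by rewrite -[A']setTI; apply: measurable_funD.
  have mB' : measurable B' by rewrite -[B']setTI; apply: mtau.
  have -> : tau' v @^-1` (A `*` B) = A' `*` B' by [].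
  transitivity (leb A' * mu B')%E; first exact: product_measure1E.
  congr (_ * _)%E; last exact: mutau.
  exact: lebesgue_measure_shift.
Qed.

Lemma lebesgue_rV_bigcup_le (R : realType) (d : nat) (I : finType)
    (F : I -> set 'rV[R]_d) (M : \bar R) :
  (forall i, pullback_measurable (F i)) -> (forall i, (lebesgue_rV (F i) <= M)%E) ->
  (lebesgue_rV (\bigcup_i F i) <= #|I|%:R%:E * M)%E.
Proof.
have [disp [T [mu [phi [tau [muE mphi _ _ _]]]]]] := lebesgue_rV_model R d.
move=> mF FM; have mP i : measurable (phi @^-1` F i) by apply: mF.
rewrite muE preimage_bigcup.
have -> : \bigcup_i (phi @^-1` F i) = \big[setU/set0]_(i <- enum I) (phi @^-1` F i).
  by rewrite -bigcup_seq; apply/seteqP; split=> t [i _ Ft]; exists i; rewrite //= mem_enum.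
rewrite cardE; elim: (enum I) => [|i s IH].
  by rewrite big_nil measure0 mul0e.
rewrite big_cons /= -natr1 addrC EFinD ge0_muleDl ?lee_fin // mul1e.
apply: (@le_trans _ _ (mu (phi @^-1` F i) +
    mu (\big[setU/set0]_(i <- s) (phi @^-1` F i)))%E).
  by apply: measureU2 => //; apply: bigsetU_measurable.
by apply: leeD IH; rewrite -muE; apply: FM.
Qed.

Lemma lebesgue_rV_le (R : realType) (d : nat) (S S' : set 'rV[R]_d) :
  pullback_measurable S -> pullback_measurable S' -> S `<=` S' ->
  (lebesgue_rV S <= lebesgue_rV S')%E.
Proof.
have [disp [T [mu [phi [tau [muE mphi _ _ _]]]]]] := lebesgue_rV_model R d.
move=> mS mS' SS'; rewrite !muE; apply: le_measure.
- by rewrite inE; apply: mS.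
- by rewrite inE; apply: mS'.
- exact: preimage_subset.
Qed.

(* Average over the translates of [S] by [s *: v], [0 <= s <= 1], and exchange
   the integrals. *)
Lemma lebesgue_rV_le_lines (R : realType) (d : nat) (S : set 'rV[R]_d)
    (c v : 'rV[R]_d) (r rho X : R) :
  0 < r -> 0 <= X -> pullback_measurable S -> S `<=` ball c r -> `|v| <= rho ->
  (forall x, covered [set s : R | 0 <= s <= 1 /\ S (x + s *: v)] X) ->
  (lebesgue_rV S <= X%:E * lebesgue_rV (ball c (r + rho)))%E.
Proof.
have [disp [T [mu [phi [tau [muE mphi phitau mtau mutau]]]]]] := lebesgue_rV_model R d.
move=> r0 X0 mS Sb vrho SX.
have rho0 : 0 <= rho by apply: le_trans vrho.
pose leb : {sigma_finite_measure set (measurableTypeR R) -> \bar R} := lebesgue_measure.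
pose psi (p : measurableTypeR R * T) : 'rV[R]_d := phi p.2 + p.1 *: v.
pose I01 : set (measurableTypeR R) := `[0, 1]%classic.
pose Z : set (measurableTypeR R * T) := (fst @^-1` I01) `&` (psi @^-1` S).
have mZ : measurable Z.
  apply: measurableI.
    rewrite -[X in measurable X]setTI; apply: measurable_fst => //.
    exact: measurable_itv.
  apply: mS => i.
  rewrite (_ : (fun _ => _) = (fun p => phi p.2 0 i + p.1 * v 0 i)); last first.
    by apply/funext => p; rewrite /psi !mxE.
  apply: measurable_funD; first exact: (measurableT_comp (mphi i)).
  by apply: measurable_funM.
have E : (leb \x mu)%E Z = (leb \x^ mu)%E Z.
  by apply: product_measure_unique => //= *; rewrite product_measure2E.
(* For each [s] in [[0, 1]] the slice of [Z] is a translate of [S], of the same measure, and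
   [[0, 1]] has length 1. *)
have E1 : (leb \x mu)%E Z = lebesgue_rV S.
  rewrite muE /product_measure1.
  transitivity (\int[leb]_s (mu (phi @^-1` S) * (\1_I01 s)%:E))%E.
    apply: eq_integral => s _ /=; rewrite indicE.
    case: (boolP (s \in I01)) => sI.
      rewrite mule1 -(mutau (s *: v) (phi @^-1` S)); last exact: mS.
      congr (mu _); apply/seteqP; split=> t /=; rewrite /xsection /= inE /Z /psi /= phitau.
        by case.
      by move=> St; split=> //; rewrite -[I01 s]/(I01 s) -inE.
    rewrite mule0 (_ : xsection Z s = set0) ?measure0 //.
    apply/seteqP; split=> t //=; rewrite /xsection /= inE => -[/= sI' _].
    by move: sI; rewrite notin_setE; apply.
  rewrite ge0_integralZl //; last first.
    by apply/measurable_EFinP; apply: measurable_indic; exact: measurable_itv.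
  rewrite integral_indic //; last exact: measurable_itv.
  rewrite setIT.
  transitivity (mu (phi @^-1` S) * 1)%E; last by rewrite mule1.
  congr (_ * _)%E.
  by rewrite /leb /I01 /= lebesgue_measure_itv /= lte_fin ltr01 -EFinB subr0.
rewrite -E1 E /product_measure2 muE.
(* The slice of [Z] at [y] costs at most [X], and is empty unless [phi y] lies in the enlarged
   ball. *)
apply: (@le_trans _ _
  (\int[mu]_y (X%:E * (\1_(phi @^-1` ball c (r + rho)) y)%:E))%E); last first.
  rewrite ge0_integralZl //; last first.
    by apply/measurable_EFinP; apply: measurable_indic; exact: pullback_measurable_ball.
  by rewrite integral_indic ?setIT //; exact: pullback_measurable_ball.
apply: ge0_le_integral => //.
- exact: measurable_fun_ysection.
- apply/measurable_EFinP; apply: measurable_funM => //.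
  by apply: measurable_indic; exact: pullback_measurable_ball.
move=> y _ /=.
have mY : measurable (ysection Z y) by exact: measurable_ysection.
have YE : ysection Z y = [set s : R | 0 <= s <= 1 /\ S (phi y + s *: v)].
  by apply/seteqP; split=> s /=; rewrite /ysection /= inE /Z /I01 /psi /= in_itv.
rewrite indicE; case: (boolP (y \in _)) => yb.
  by rewrite mule1; apply: covered_lebesgue => //; rewrite YE; apply: SX.
rewrite mule0 (_ : ysection Z y = set0) ?measure0 // YE.
apply/seteqP; split=> s //= [/andP[s0 s1] /Sb Sy].
move: yb; rewrite notin_setE; apply => /=.
move: Sy; rewrite -!ball_normE /= => Sy.
have -> : c - phi y = (c - (phi y + s *: v)) + s *: v by rewrite opprD addrA subrK.
rewrite (le_lt_trans (ler_normD _ _)) // ltr_leD // normrZ (ger0_norm s0).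
by apply: le_trans vrho; rewrite ler_piMl.
Qed.

(** * Nondegenerate maps *)

Lemma ler_norm_entry (R : realType) (n : nat) (x : 'rV[R]_n) j : `|x 0 j| <= `|x|.
Proof.
rewrite [leRHS]/Num.norm /= mx_normrE.
exact: (le_bigmax _ (fun i : 'I_1 * 'I_n => `|x i.1 i.2|) (0, j)).
Qed.

Lemma ge_norm_rV (R : realType) (n : nat) (x : 'rV[R]_n) (rho : R) : 0 < rho ->
  rho <= `|x| <-> exists j, rho <= `|x 0 j|.
Proof.
move=> rho0; split=> [|[j /le_trans]]; last by apply; exact: ler_norm_entry.
apply: contraPP => H; apply/negP; rewrite -ltNge /Num.norm /= mx_normrE.
apply: bigmax_lt => // -[i j] _; rewrite (ord1 i) ltNge; apply/negP => h.
by apply: H; exists j.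
Qed.

Section NondegenerateLowerBound.
Variables (R : realType) (n : nat).
Implicit Types (X : seq 'rV[R]_n) (a : 'rV[R]_n).

(** Expanding each unit vector in the spanning family recovers the entries of [a] from its pairings
    with the family. If all pairings were at most [|a| / K], then [|a| <= (K - 1) * |a| / K]. *)
Lemma span_lower_bound X : (<<X>> = fullv)%VS -> exists2 kappa : R, 0 < kappa &
  forall a, a != 0 -> exists2 v, v \in X & kappa * `|a| <= `|\sum_j v 0 j * a 0 j|.
Proof.
move=> Xfull; pose Y := in_tuple X.
pose K := 1 + \sum_j \sum_i `|coord Y i (delta_mx 0 j)|.
have K1 : 0 < K by rewrite ltr_pwDl // sumr_ge0 // => j _; rewrite sumr_ge0.
exists K^-1; first by rewrite invr_gt0.
move=> a a0; apply: contrapT => H.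
have lt v : v \in X -> `|\sum_j v 0 j * a 0 j| <= K^-1 * `|a|.
  by move=> vX; rewrite leNgt; apply/negP => /ltW h; apply: H; exists v.
have na : 0 < `|a| by rewrite normr_gt0.
have Ka : 0 <= K^-1 * `|a| by rewrite mulr_ge0 ?invr_ge0 // ltW.
have aj j : `|a 0 j| <= (K - 1) * (K^-1 * `|a|).
  have E : a 0 j = \sum_i coord Y i (delta_mx 0 j) * (\sum_k Y`_i 0 k * a 0 k).
    transitivity (\sum_k (delta_mx 0 j : 'rV[R]_n) 0 k * a 0 k).
      rewrite (bigD1 j) //= mxE !eqxx mul1r big1 ?addr0 // => k kj.
      by rewrite mxE (negbTE kj) mul0r.
    rewrite {1}(@coord_span _ _ _ Y (delta_mx 0 j)); last by rewrite Xfull memvf.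
    under eq_bigr do rewrite summxE mulr_suml.
    rewrite exchange_big /=; apply: eq_bigr => i _; rewrite mulr_sumr.
    by apply: eq_bigr => k _; rewrite mxE mulrA.
  rewrite E (le_trans (ler_norm_sum _ _ _)) // /K addrAC subrr add0r.
  rewrite mulr_suml (bigD1 j) //= ler_wpDr //.
    by rewrite sumr_ge0 // => k _; rewrite mulr_ge0 // sumr_ge0.
  rewrite mulr_suml; apply: ler_sum => i _; rewrite normrM ler_wpM2l // lt //.
  by rewrite mem_nth.
have : `|a| <= (K - 1) * (K^-1 * `|a|).
  rewrite {1}/Num.norm /= mx_normrE; apply: bigmax_le => [|[i j] _ /=].
    by rewrite mulr_ge0 // /K addrAC subrr add0r sumr_ge0 // => k _; rewrite sumr_ge0.
  by rewrite (ord1 i).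
apply/negP; rewrite -ltNge mulrBl mul1r mulrA divff ?gt_eqF // mul1r.
by rewrite ltrBlDr ltrDl mulr_gt0 // invr_gt0.
Qed.

Lemma nondegenerate_lower_bound (d l : nat) (f : 'rV[R]_d -> 'rV[R]_n) x0 :
  l_nondegenerate l f x0 -> exists2 kappa : R, 0 < kappa &
  forall a, a != 0 -> exists2 beta : 'I_d -> nat, (1 <= \sum_i beta i <= l)%N &
    kappa * `|a| <= `|lin_form (mpartial beta f) a x0|.
Proof.
move=> [_ /span_lower_bound[kappa k0 H]]; exists kappa => // a /H[v].
move=> /mapP[beta]; rewrite mem_filter => /andP[bl _] -> h.
by exists (fun i => beta i : nat); rewrite ?lin_formE.
Qed.

Lemma lin_form_dist (d : nat) (F : 'rV[R]_d -> 'rV[R]_n) a x y (e : R) :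
  `|F x - F y| <= e -> `|lin_form F a x - lin_form F a y| <= n%:R * (e * `|a|).
Proof.
move=> Fe; rewrite !lin_formE -sumrB (le_trans (ler_norm_sum _ _ _)) //.
apply: (@le_trans _ _ (\sum_(j < n) e * `|a|)); last by rewrite sumr_const card_ord mulr_natl.
apply: ler_sum => j _; rewrite -mulrBl normrM; apply: ler_pM => //.
  by apply: le_trans Fe; have := ler_norm_entry (F x - F y) j; rewrite !mxE.
exact: ler_norm_entry.
Qed.

End NondegenerateLowerBound.

(** One neighbourhood must serve all multi-indices of order at most [l]; encoded as finite
    functions, they are finitely many. *)
Lemma mpartial_near (R : realType) (d n l : nat) (f : 'rV[R]_d -> 'rV[R]_n) A
    (x0 : 'rV[R]_d) (e : R) : open A -> A x0 -> C_on l A f -> 0 < e ->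
  \forall x \near x0, forall gamma : 'I_d -> nat, (\sum_i gamma i <= l)%N ->
    `|mpartial gamma f x - mpartial gamma f x0| <= e.
Proof.
move=> oA Ax0 Cf e0.
have near_b (b : {ffun 'I_d -> 'I_l.+1}) : \forall x \near x0, (\sum_i b i <= l)%N ->
    `|mpartial (fun i => b i : nat) f x - mpartial (fun i => b i : nat) f x0| <= e.
  have [bl|bl] := boolP (\sum_i b i <= l)%N; last first.
    by apply: (@filterS _ (nbhs x0) _ setT) filterT.
  have [cb _] : C_on 0 A (mpartial (fun i => b i : nat) f).
    rewrite mpartialE; apply: C_on_partials; apply: C_on_le Cf.
    by rewrite size_multi_word addn0.
  have /cvgrPdist_le /(_ _ e0) := cb _ Ax0.
  by apply: filterS => x /= h _; rewrite distrC.
have near_all := filter_forall (nbhs_filter x0) near_b.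
apply: filterS near_all => x H gamma gl.
have gil i : (gamma i < l.+1)%N.
  by rewrite ltnS; apply: leq_trans gl; rewrite (bigD1 i) //= leq_addr.
pose b : {ffun 'I_d -> 'I_l.+1} := [ffun i => Ordinal (gil i)].
have bE : (fun i => b i : nat) = gamma by apply/funext => i; rewrite ffunE.
by have := H b; rewrite bE; apply; rewrite (eq_bigr gamma) // => i _; rewrite ffunE.
Qed.

Section SteepMeasurability.
Variables (R : realType) (d : nat).
Implicit Types (B : set 'rV[R]_d) (g h : 'rV[R]_d -> R^o).

Lemma open_comp_in B g (P : set R) : open B -> open P ->
  (forall x, B x -> {for x, continuous g}) -> open [set x | B x /\ P (g x)].
Proof.
move=> oB oP cg; rewrite openE => x [Bx Pgx]; rewrite /interior.
apply: filterI; first exact: open_nbhs_nbhs.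
exact: (cg _ Bx) (open_nbhs_nbhs (conj oP Pgx)).
Qed.

Lemma open_near_int (delta : R) : open (near_int delta : set R).
Proof.
have -> : (near_int delta : set R) = \bigcup_(a : int) ball (- a%:~R : R) delta.
  apply/seteqP; split=> y; rewrite /near_int /=.
    by move=> [a ha]; exists a => //; rewrite /ball /= -opprD normrN.
  by move=> [a _]; rewrite /ball /= -opprD normrN => ha; exists a.
by apply: bigcup_open => a _; exact: ball_open.
Qed.

(** As [g] and [h] are continuous only on [B], the set is presented as a difference of two open
    subsets of [B]. *)
Lemma pullback_measurable_steep B g h (delta rho : R) : open B ->
  (forall x, B x -> {for x, continuous g}) ->
  (forall x, B x -> {for x, continuous h}) ->
  pullback_measurable [set x | [/\ B x, near_int delta (g x) & rho <= `|h x|]].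
Proof.
move=> oB cg ch.
have -> : [set x | [/\ B x, near_int delta (g x) & rho <= `|h x|]] =
    [set x | B x /\ near_int delta (g x)] `&` ~` [set x | B x /\ ball (0 : R) rho (h x)].
  apply/seteqP; split=> x /=; rewrite /ball /= sub0r normrN.
    by move=> [Bx nx hx]; split=> // -[_]; rewrite ltNge hx.
  by move=> [[Bx nx] hx]; split=> //; rewrite leNgt; apply/negP => ?; apply: hx.
apply: pullback_measurableI.
  by apply: open_pullback_measurable; apply: (@open_comp_in B g _ oB _ cg); apply: open_near_int.
apply: pullback_measurableC; apply: open_pullback_measurable.
apply: (@open_comp_in B h _ oB _ ch); apply: ball_open.
Qed.

End SteepMeasurability.

Section SteepSets.
Variables (R : realType) (d : nat).
Implicit Types (g : 'rV[R]_d -> R^o) (A : set 'rV[R]_d) (x v w c : 'rV[R]_d).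

Lemma mpartial0 g : mpartial (fun _ : 'I_d => 0%N) g = g.
Proof.
by rewrite mpartialE (size0nil (s := multi_word _)) // size_multi_word big1.
Qed.

Lemma is_interval_line_ball x0 x v (rho : R) :
  is_interval [set s : R | 0 <= s <= 1 /\ ball x0 rho (x + s *: v)].
Proof.
move=> s t [/andP[s0 _] [rho0 hs]] [/andP[_ t1] [_ ht]] z /andP[sz zt].
split; first by rewrite (le_trans s0) ?(le_trans zt).
split=> // i j; have := hs i j; have := ht i j.
rewrite /ball /= !mxE !ltr_norml !opprD => /andP[t2 t3] /andP[s2 s3].
case: (leP 0 (v i j)) => v0.
  have zv : s * v i j <= z * v i j by rewrite ler_wpM2r.
  have vt : z * v i j <= t * v i j by rewrite ler_wpM2r.
  lra.
have zv : z * v i j <= s * v i j by rewrite ler_wnM2r // ltW.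
have vt : t * v i j <= z * v i j by rewrite ler_wnM2r // ltW.
lra.
Qed.

(** Half of the gradient threshold [r^-1] is what survives when a coordinate direction is replaced
    by [w0] or [w_i]. *)
Definition steep_set g c (r delta : R) w : set 'rV[R]_d :=
  [set x | [/\ ball c r x, near_int delta (g x) &
    (2 * r)^-1 <= `|jet_dir w (jet g x) (fun=> 0%N)|]].

Lemma jet_dirE A g w x : open A -> C_on 1 A g -> A x ->
  jet_dir w (jet g x) (fun=> 0%N) = \sum_i w 0 i * partial i g x.
Proof.
move=> oA Cg Ax; apply: eq_bigr => i _; congr (_ * _).
by rewrite /jet -(partial_mpartial i oA Cg _ Ax) ?mpartial0 // big1.
Qed.

Lemma pullback_measurable_steep_set A g c (r delta : R) w : open A -> C_on 1 A g ->
  ball c r `<=` A -> pullback_measurable (steep_set g c r delta w).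
Proof.
move=> oA Cg cA; have [cg dg] := Cg.
have -> : steep_set g c r delta w = [set x | [/\ ball c r x, near_int delta (g x) &
    (2 * r)^-1 <= `|\sum_i w 0 i * partial i g x|]].
  by apply/seteqP; split=> x [xb xn xs]; split=> //; move: xs;
    rewrite (jet_dirE w oA Cg (cA _ xb)).
apply: pullback_measurable_steep.
- exact: ball_open.
- by move=> x /cA/cg.
- move=> x /cA Ax.
  apply: (@cvg_big R^o _ +%R 0 predT add_continuous _ (nbhs x)) => i _.
  by apply: (@cvgMl_tmp R _ (nbhs x)); apply: (dg i).2.1.
Qed.

(** Rescaling [w] to [r *: w] turns the threshold [(2 * r)^-1] into the [1/2] of the one-dimensional
    estimate, and [q] into [r ^+ k * q]. The segment may start anywhere, so it is clipped to
    [ball x0 rho]; convexity keeps it an interval. *)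
Lemma steep_set_measure A g (l k : nat) (x0 c w : 'rV[R]_d) (rho r delta N q : R) :
  open A -> C_on l A g -> (1 <= k <= l)%N -> ball x0 rho `<=` A ->
  ball c r `<=` ball x0 rho -> 0 < r -> 0 < delta -> `|w| <= N -> q != 0 ->
  (forall x, ball x0 rho x ->
    `|iter k (jet_dir w) (jet g x) (fun=> 0%N) - q| <= `|q| / 2) ->
  (lebesgue_rV (steep_set g c r delta w) <=
    (368 * 2 ^+ l * delta)%:E * lebesgue_rV (ball c (r + r * N)))%E.
Proof.
move=> oA Cg /andP[k1 kl] xA cx r0 d0 wN q0 hq.
have C1 : C_on 1 A g by apply: C_on_le Cg; apply: leq_trans kl.
have X0 : 0 <= 368 * 2 ^+ l * delta by rewrite !mulr_ge0 ?exprn_ge0 // ltW.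
apply: (@lebesgue_rV_le_lines _ _ _ c (r *: w) r (r * N)) => //.
- apply: (pullback_measurable_steep_set _ _ oA C1) => x /cx; exact: xA.
- by move=> x [].
- by rewrite normrZ gtr0_norm // ler_pM2l.
move=> x; pose v := r *: w.
pose S : set R := [set s | 0 <= s <= 1 /\ ball x0 rho (x + s *: v)].
pose u m (s : R) := iter m (jet_dir v) (jet g (x + s *: v)) (fun=> 0%N).
have cov : covered (steep_near_int S delta u) (368 * 2 ^+ k * delta).
  apply: (@steep_near_int_covered _ S delta (r ^+ k * q) k u) => //.
  - exact: is_interval_line_ball.
  - move=> s t [/andP[s0 s1] _] [/andP[t0 t1] _]; rewrite ler_norml; lra.
  - move=> i ik s [_ /xA As]; apply: (is_derive_jet_dir oA Cg As).
    by rewrite big1 // addn0 (leq_trans ik).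
  - by rewrite mulf_neq0 // expf_neq0 // gt_eqF.
  - move=> s [_ /hq h]; rewrite /u /v iter_jet_dirZ -mulrBr !normrM -mulrA.
    by rewrite ler_wpM2l.
apply: (covered_sub _ _ cov); last first.
  by rewrite ler_wpM2r ?(ltW d0) // ler_wpM2l // ler_weXn2l // ler1n.
move=> s [s01 [sb sn sw]]; split; first by split=> //; apply: cx.
split; last by rewrite /u /= /jet mpartial0.
have -> : u 1%N s = r * jet_dir w (jet g (x + s *: v)) (fun=> 0%N).
  by rewrite /u {1}/v iter_jet_dirZ expr1.
rewrite normrM gtr0_norm //.
have : r * (2 * r)^-1 <= r * `|jet_dir w (jet g (x + s *: v)) (fun=> 0%N)|.
  by rewrite ler_pM2l.
by rewrite invfM mulrCA divff ?mulr1 // gt_eqF.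
Qed.

End SteepSets.

Lemma Sfrak2_measurable (R : realType) (d n : nat) (U A : set 'rV[R]_d)
    (f : 'rV[R]_d -> 'rV[R]_n) (c : 'rV[R]_d) (r delta : R) a :
  0 < r -> C_on 1 A (lin_form f a : _ -> R^o) -> ball c r `<=` A ->
  ball c r `<=` U -> pullback_measurable (Sfrak2 U f r delta a `&` ball c r).
Proof.
move=> r0 [cg dg] cA cU.
have -> : Sfrak2 U f r delta a `&` ball c r =
    \bigcup_(i : 'I_d) [set x | [/\ ball c r x, near_int delta (lin_form f a x) &
      r^-1 <= `|partial i (lin_form f a : _ -> R^o) x|]].
  apply/seteqP; split=> x.
    move=> [[Ux nx]]; rewrite (ge_norm_rV _ (_ : 0 < r^-1)) ?invr_gt0 // => -[i hi] xb.
    by exists i => //; split=> //; move: hi; rewrite mxE.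
  move=> [i _ [xb nx hi]]; split=> //; split=> //; first exact: cU.
  by apply/ge_norm_rV; rewrite ?invr_gt0 //; exists i; rewrite mxE.
apply: pullback_measurable_bigcup => i; apply: pullback_measurable_steep.
- exact: ball_open.
- by move=> x /cA/cg.
- by move=> x /cA Ax; apply: (dg i).2.1.
Qed.

Lemma grad_lin_form0 (R : realType) (d n : nat) (f : 'rV[R]_d -> 'rV[R]_n) x :
  grad (lin_form f 0) x = 0.
Proof.
apply/rowP => i; rewrite !mxE.
have -> : lin_form f 0 = cst 0.
  by apply/funext => y; rewrite /lin_form trmx0 mulmx0 mxE.
exact: derive_cst.
Qed.

Lemma lebesgue_rV0 (R : realType) (d : nat) : lebesgue_rV (set0 : set 'rV[R]_d) = 0%E.
Proof.
have [disp [T [mu [phi [tau [muE _ _ _ _]]]]]] := lebesgue_rV_model R d.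
by rewrite muE preimage_set0 measure0.
Qed.

Lemma Sfrak2_measure (R : realType) (d n l k : nat) (U A : set 'rV[R]_d)
    (f : 'rV[R]_d -> 'rV[R]_n) (x0 c w0 : 'rV[R]_d) (s : 'I_d -> nat)
    (rho r delta N kappa : R) a :
  open A -> C_on l A f -> (1 <= k <= l)%N -> ball x0 rho `<=` A `&` U ->
  ball c r `<=` ball x0 rho -> 0 < r -> 0 < delta -> (forall i, (0 < s i)%N) ->
  0 < kappa ->
  (forall o : option 'I_d,
    let w := if o is Some i then w0 + (s i)%:R *: delta_mx 0 i else w0 in
    let P x := iter k (jet_dir w) (jet (lin_form f a : _ -> R^o) x) (fun=> 0%N) in
    [/\ `|w| <= N, kappa <= `|P x0| &
      forall x, ball x0 rho x -> `|P x - P x0| <= kappa / 2]) ->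
  (lebesgue_rV (Sfrak2 U f r delta a `&` ball c r) <=
    d.+1%:R%:E * ((368 * 2 ^+ l * delta)%:E * lebesgue_rV (ball c (r + r * N))))%E.
Proof.
move=> oA Cf kl xAU cx r0 d0 s0 kappa0 hw.
have xA : ball x0 rho `<=` A by move=> x /xAU[].
pose g : 'rV[R]_d -> R^o := lin_form f a.
have Cg : C_on l A g by apply: C_on_lin_form.
have C1 : C_on 1 A g.
  by apply: C_on_le Cg; case/andP: kl => k1; apply: leq_trans.
have cA : ball c r `<=` A by move=> x /cx/xA.
pose w (o : option 'I_d) := if o is Some i then w0 + (s i)%:R *: delta_mx 0 i else w0.
have mS o : pullback_measurable (steep_set g c r delta (w o)).
  exact: (pullback_measurable_steep_set _ _ oA C1).
have sub : Sfrak2 U f r delta a `&` ball c r `<=`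
    \bigcup_(o : option 'I_d) steep_set g c r delta (w o).
  move=> x [[Ux nx]]; rewrite (ge_norm_rV _ (_ : 0 < r^-1)) ?invr_gt0 // => -[i hi] xb.
  pose D v := jet_dir v (jet g x) (fun=> 0%N).
  (* Since [s i >= 1], the two directional derivatives differ by at least [r^-1], so one of them is
     at least [(2 * r)^-1]. *)
  have E : D (w (Some i)) = D w0 + (s i)%:R * partial i g x.
    rewrite /D jet_dirD jet_dir_delta /jet.
    by rewrite -(partial_mpartial i oA C1 _ (cA _ xb)) ?mpartial0 // big1.
  have hi' : r^-1 <= `|(s i)%:R * partial i g x|.
    rewrite normrM normr_nat; move: hi; rewrite mxE => /le_trans; apply.
    by rewrite ler_peMl // ler1n.
  have [h|h] := leP (2 * r)^-1 `|D w0|; first by exists None.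
  exists (Some i) => //; split=> //.
  rewrite leNgt; apply/negP; rewrite -/(D _) E => h'.
  have r2 : r^-1 = (2 * r)^-1 + (2 * r)^-1 by field; rewrite gt_eqF.
  have := ler_normB (D w0 + (s i)%:R * partial i g x) (D w0).
  rewrite addrAC subrr add0r; move: hi' h h'; rewrite r2.
  move: (`|D w0|) (`|_ * _|) (`|D w0 + _|) => y1 y2 y3; lra.
apply: le_trans (lebesgue_rV_le _ _ sub) _.
- by apply: (Sfrak2_measurable _ r0 C1 cA) => x /cx/xAU[].
- exact: pullback_measurable_bigcup.
have -> : d.+1 = #|{: option 'I_d}| by rewrite card_option card_ord.
apply: lebesgue_rV_bigcup_le => // o.
have [wN kP hP] := hw o.
apply: (@steep_set_measure R d A g l k x0 c (w o) rho r delta N _ oA Cg kl xA cx r0 d0 wN).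
  by rewrite -normr_gt0; apply: lt_le_trans kP.
move=> x /hP h; apply: le_trans h _.
by rewrite ler_pM2r // invr_gt0.
Qed.

Theorem theorem3p4 (R : realType) (l d : nat) :
  exists C : R, 0 < C /\
  forall (n : nat) (U : set 'rV[R]_d) (x0 : 'rV[R]_d)
    (f : 'rV[R]_d -> 'rV[R]_n),
  open U -> U x0 -> l_nondegenerate l f x0 -> C_near 2 f x0 ->
  exists r0 C1 : R,
  [/\ 0 < r0, 0 < C1, ball x0 (2 * r0) `<=` U &
   forall (c : 'rV[R]_d) (r : R), 0 < r -> ball c r `<=` ball x0 r0 ->
   forall (delta : R) (a : 'rV[R]_n), 0 < delta ->
   let L := sup_partial2 f c r in
   (maxe ((4 * n%:R)%:E * L * (r ^+ 2)%:E)^-1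
         ((n%:R * d%:R)%:E * L / (C1 ^+ 2)%:E) <= `|a|%:E)%E ->
   (lebesgue_rV (Sfrak2 U f r delta a `&` ball c r)
      <= (C * delta)%:E * lebesgue_rV (ball c r))%E].
Proof.
(* [N] bounds the directions. In [M] the factors are the number of directions, the one-dimensional
   constant, and the volume ratio of the balls of radii [r + r * N] and [r]. *)
pose N : R := (l.+1 ^ 2)%:R.
pose M : R := d.+1%:R * (368 * 2 ^+ l) * (1 + N) ^+ d.
have N0 : 0 <= N by exact: ler0n.
have M0 : 0 < M by rewrite !mulr_gt0 ?exprn_gt0 ?ltr_pwDl ?ltr0n.
exists M; split=> // n U x0 f oU Ux0 nd _.
have [[A [oA Ax0] Cf] _] := nd.
have [kappa k0 low] := nondegenerate_lower_bound nd.
have [c' c'0 dirs] := jet_directions R d l.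
pose B : R := 1 + d%:R * N.
have B1 : 1 <= B by rewrite lerDl mulr_ge0.
(* [B ^+ l] absorbs the powers of the sums of entries of a direction, [n.+1] (nonzero even for
   [n = 0]) the passage from [f] to its linear form. The k-th derivatives then vary by at most half
   of their lower bound. *)
pose e := c' * kappa / 2 / (B ^+ l * n.+1%:R).
have B0 : 0 < B by apply: lt_le_trans B1.
have BN : 0 < B ^+ l * n.+1%:R by rewrite mulr_gt0 ?exprn_gt0 ?ltr0n.
have e0 : 0 < e by rewrite divr_gt0 // divr_gt0 // mulr_gt0.
have : \forall x \near x0, [/\ A x, U x & forall gamma : 'I_d -> nat,
    (\sum_i gamma i <= l)%N -> `|mpartial gamma f x - mpartial gamma f x0| <= e].
  have nA := open_nbhs_nbhs (conj oA Ax0); have nU := open_nbhs_nbhs (conj oU Ux0).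
  have nM := mpartial_near oA Ax0 Cf e0.
  by apply: filterS3 nA nU nM => x ? ? ?; split.
move=> /nbhs_ballP[rho /= rho0 near_x0].
exists (rho / 2), 1; split=> //; first by rewrite divr_gt0.
  by move=> x; rewrite mulrC divfK // => /near_x0[].
move=> c r r0 cx delta a d0 /= _.
(* Nondegeneracy bounds nothing from below for [a = 0], but then the gradient vanishes and the set
   is empty. *)
have [->|a0] := eqVneq a 0.
  have -> : Sfrak2 U f r delta 0 `&` ball c r = set0.
    apply/seteqP; split=> // x [[_ _]].
    by rewrite grad_lin_form0 normr0 leNgt invr_gt0 r0.
  rewrite lebesgue_rV0 lebesgue_rV_ball // -EFinM lee_fin.
  by apply: mulr_ge0; [rewrite mulr_ge0 ?ltW|rewrite exprn_ge0 // mulr_ge0 // ltW].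
have [beta bl hbeta] := low _ a0.
have na : 0 < `|a| by rewrite normr_gt0.
pose g : 'rV[R]_d -> R^o := lin_form f a.
have jetE x gamma : A x -> (\sum_i gamma i <= l)%N ->
    jet g x gamma = lin_form (mpartial gamma f) a x.
  by move=> Ax gl; exact: (mpartial_lin_form a oA Cf gl Ax).
have hb : kappa * `|a| <= `|jet g x0 beta| by rewrite jetE //; case/andP: bl.
have [k [w0 [s [kl s0 [w0N w0k] ws]]]] := dirs _ _ _ bl (mulr_gt0 k0 na) hb.
have cx' : ball c r `<=` ball x0 rho.
  apply: (subset_trans cx); apply: le_ball.
  by rewrite ler_pdivrMr // mulr_natr mulr2n lerDl ltW.
have xAU : ball x0 rho `<=` A `&` U by move=> x /near_x0[].
have near_dir w x : `|w| <= N -> ball x0 rho x ->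
    `|iter k (jet_dir w) (jet g x) (fun=> 0%N) -
      iter k (jet_dir w) (jet g x0) (fun=> 0%N)| <= c' * (kappa * `|a|) / 2.
  move=> wN xb; have [Ax _ hx] := near_x0 _ xb.
  have h gamma : (\sum_i gamma i = k + \sum_(i < d) 0)%N ->
      `|jet g x gamma - jet g x0 gamma| <= n%:R * (e * `|a|).
    rewrite [X in (_ = k + X)%N]big1 // addn0 => gk; have gl : (\sum_i gamma i <= l)%N.
      by rewrite gk; case/andP: kl.
    by rewrite !jetE //; apply: lin_form_dist; apply: hx.
  apply: le_trans (iter_jet_dir_dist w h) _.
  have sB : (\sum_i `|w 0 i|) ^+ k <= B ^+ l.
    apply: (@le_trans _ _ (B ^+ k)).
      apply: lerXn2r; rewrite ?nnegrE ?sumr_ge0 ?(ltW B0) //.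
      apply: (@le_trans _ _ (\sum_(i < d) N)).
        by apply: ler_sum => i _; apply: le_trans wN; apply: ler_norm_entry.
      by rewrite sumr_const card_ord -[leLHS]mulr_natl lerDr.
    by rewrite ler_weXn2l //; case/andP: kl.
  have ea : 0 <= e * `|a| by rewrite mulr_ge0 // ltW.
  apply: (@le_trans _ _ (B ^+ l * (n.+1%:R * (e * `|a|)))).
    apply: ler_pM => //; first by rewrite exprn_ge0 // sumr_ge0.
      by rewrite mulr_ge0.
    by rewrite ler_wpM2r // ler_nat.
  rewrite mulrA mulrA [_ * e]mulrC /e divfK ?gt_eqF //.
  by rewrite le_eqVlt; apply/orP; left; apply/eqP; ring.
have := @Sfrak2_measure R d n l k U A f x0 c w0 s rho r delta N
  (c' * (kappa * `|a|)) a oA Cf kl xAU cx' r0 d0 s0.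
rewrite !mulr_gt0 // => /(_ isT) main.
apply: le_trans (main _) _.
  case=> [i|]; last by split=> // x; apply: near_dir.
  by have [wN wk] := ws i; split=> // x; apply: near_dir.
have rN : 0 < r + r * N by rewrite ltr_pwDl // mulr_ge0 // ltW.
rewrite !lebesgue_rV_ball // -!EFinM lee_fin.
have -> : 2 * (r + r * N) = (2 * r) * (1 + N) by ring.
rewrite exprMn /M le_eqVlt; apply/orP; left; apply/eqP.
by move: ((2 * r) ^+ d) ((1 + N) ^+ d) (2 ^+ l) => y1 y2 y3; ring.
Qed.
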